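(* Let $\mathcal T_1\subseteq\mathcal T_2\subseteq\mathcal T_G$ be nonempty convex sets. For $i\in\{1,2\}$ let $\mathcal C_i$ be a closed convex cone and $\mathcal S_i$ a closed convex set with $\overline{\mathcal T_i}=\{\Phi\in\mathcal C_i:\sum_m\Phi_m\in\mathcal S_i\}$, $\mathcal C_1\subseteq\mathcal C_2\subseteq\mathcal C_G$, and $\mathcal S_1\subseteq\mathcal S_2\subseteq\mathcal S_G$. Let (P$_i$) denote Problem (P) with $\mathcal T=\mathcal T_i$, and (D$_i$) denote Problem (D) with $(\mathcal C,\mathcal S)=(\mathcal C_i,\mathcal S_i)$ (same data $c_m,a_{j,m},b_j$; the closure assumption on $\mathsf P$ is assumed for both). Assume the feasible set of (P$_1$) is nonempty and that (D$_2$) has an optimal solution. Consider the statements: (1) the optimal values of (P$_1$) and (P$_2$) coincide (equivalently, those of (D$_1$) and (D$_2$) coincide); (2) there is an optimal solution $(\chi^\star,q^\star)$ of (D$_1$) that is feasible for (D$_2$) and satisfies $\lambda_{\mathcal S_1}(\chi^\star)=\lambda_{\mathcal S_2}(\chi^\star)$; (3) every optimal solution of (D$_2$) is optimal for (D$_1$); (4) there is an optimal solution $(\chi^\star,q^\star)$ of (D$_1$) that is feasible for (D$_2$) and satisfies $\chi^\star\in\mathrm{Lin}(\mathrm{Chn}_{\tilde{\mathcal V}})$. Then $(1)\Leftrightarrow(2)\Rightarrow(3)$. Moreover, if $\mathcal S_2=\mathcal S_G$, then (1), (2), (3), (4) are all equivalent.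
   Context: Standing setup. All Hilbert spaces are finite-dimensional complex. Fix an integer $T\ge1$ and systems $\mathcal V_1,\dots,\mathcal V_T,\mathcal W_1,\dots,\mathcal W_T$; set $\mathcal W_0:=\mathbb C$ and $\tilde{\mathcal V}:=\mathcal W_T\otimes\mathcal V_T\otimes\cdots\otimes\mathcal W_1\otimes\mathcal V_1$. For a system $\mathcal X$, $N_{\mathcal X}$ is its dimension, $I_{\mathcal X}$ its identity, $\mathrm{Her}_{\mathcal X}$ the real Hilbert space of Hermitian operators on $\mathcal X$ with inner product $\langle X,Y\rangle=\mathrm{Tr}(XY)$, and $\mathrm{Pos}_{\mathcal X}$ the set of positive semidefinite operators; $X\ge Y$ means $X-Y$ is positive semidefinite; $\mathrm{Tr}_{\mathcal X}$ is the partial trace over $\mathcal X$. For a subset $A$ of a real vector space, $\mathrm{Lin}(A)$ is its real linear span and $\overline A$ its closure. $\mathcal I_n:=\{0,\dots,n-1\}$. Combs: $\mathrm{Chn}_{\tilde{\mathcal V}}$ is the set of $c\in\mathrm{Pos}_{\tilde{\mathcal V}}$ for which there exist $c_t\in\mathrm{Pos}_{\mathcal W_t\otimes\mathcal V_t\otimes\cdots\otimes\mathcal W_1\otimes\mathcal V_1}$ ($t=1,\dots,T$) with $c_T=c$, $\mathrm{Tr}_{\mathcal W_t}c_t=I_{\mathcal V_t}\otimes c_{t-1}$ for $2\le t\le T$, and $\mathrm{Tr}_{\mathcal W_1}c_1=I_{\mathcal V_1}$. $\mathcal S_G$ is the set of operators $I_{\mathcal W_T}\otimes\tau_T$ where $\tau_t\in\mathrm{Pos}_{\mathcal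 V_t\otimes\mathcal W_{t-1}\otimes\mathcal V_{t-1}\otimes\cdots\otimes\mathcal W_1\otimes\mathcal V_1}$ ($t=1,\dots,T$) satisfy $\mathrm{Tr}\,\tau_1=1$ and $\mathrm{Tr}_{\mathcal V_t}\tau_t=I_{\mathcal W_{t-1}}\otimes\tau_{t-1}$ for $2\le t\le T$. Fix an integer $M\ge2$; $\mathcal C_G:=\mathrm{Pos}_{\tilde{\mathcal V}}^M$ and the set of (all) testers is $\mathcal T_G:=\{\Phi=\{\Phi_m\}_{m=0}^{M-1}\in\mathcal C_G:\sum_m\Phi_m\in\mathcal S_G\}$. Problem data: an integer $J\ge0$, $c_m,a_{j,m}\in\mathrm{Her}_{\tilde{\mathcal V}}$ and $b_j\in\mathbb R$ ($m\in\mathcal I_M$, $j\in\mathcal I_J$); $\eta_j(\Phi):=\sum_m\langle\Phi_m,a_{j,m}\rangle-b_j$ and $P(\Phi):=\sum_m\langle\Phi_m,c_m\rangle$. $\mathcal T$ is a nonempty convex subset of $\mathcal T_G$, $\mathsf P:=\{\Phi\in\mathcal T:\eta_j(\Phi)\le0\ \forall j\in\mathcal I_J\}$, and it is assumed that $\overline{\mathsf P}=\{\Phi\in\overline{\mathcal T}:\eta_j(\Phi)\le0\ \forall j\}$. $\mathcal C\subseteq\mathcal C_G$ is a closed convex cone and $\mathcal S\subseteq\mathcal S_G$ a closed convex set with $\overline{\mathcal T}=\{\Phi\in\mathcal C:\sum_m\Phi_m\in\mathcal S\}$. Problem (P): maximize $P(\Phi)$ subject to $\Phi\in\mathsf P$;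 its optimal value is $\sup_{\Phi\in\mathsf P}P(\Phi)$ ($-\infty$ if $\mathsf P=\emptyset$); an optimal solution is a $\Phi\in\mathsf P$ attaining it. Dual: $\mathcal C^*:=\{\{y_m\}_{m}\in\mathrm{Her}_{\tilde{\mathcal V}}^M:\sum_m\langle\Phi_m,y_m\rangle\ge0\ \forall\Phi\in\mathcal C\}$; $\lambda_{\mathcal S}(\chi):=\sup_{\varphi\in\mathcal S}\langle\varphi,\chi\rangle$; $z_m(q):=c_m-\sum_jq_ja_{j,m}$ for $q=\{q_j\}\in\mathbb R_+^J$; $\mathsf D:=\{(\chi,q)\in\mathrm{Her}_{\tilde{\mathcal V}}\times\mathbb R_+^J:\{\chi-z_m(q)\}_{m}\in\mathcal C^*\}$; $D_{\mathcal S}(\chi,q):=\lambda_{\mathcal S}(\chi)+\sum_jq_jb_j$. Problem (D): minimize $D_{\mathcal S}(\chi,q)$ over $(\chi,q)\in\mathsf D$; its optimal value is the infimum ($+\infty$ if $\mathsf D=\emptyset$); an optimal solution attains it. *)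

(* Defs.v *)
From HB Require Import structures.
From mathcomp Require Import all_boot all_order all_algebra.
From mathcomp Require Import boolp classical_sets reals constructive_ereal ereal.
From mathcomp Require Import complex mxtens.

Set Implicit Arguments.
Unset Strict Implicit.
Unset Printing Implicit Defensive.

Import Order.TTheory GRing.Theory Num.Theory.
Local Open Scope ring_scope.
Local Open Scope classical_set_scope.

Section QuantumOpt.
Variable R : realType.
Local Notation C := (R[i]).

Definition adj {n} (A : 'M[C]_n) : 'M[C]_n := map_mx (@conjc R) A^T.
Definition herm {n} (A : 'M[C]_n) : Prop := A = adj A.
Definition psd {n} (A : 'M[C]_n) : Prop :=
  herm A /\ forall v : 'cV[C]_n, 0 <= ((map_mx (@conjc R) v)^T *m A *m v) 0 0.

(** Hilbert-Schmidt inner product <X,Y> = Tr(XY) (real for Hermitian X,Y). *)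
Definition hinner {n} (A B : 'M[C]_n) : R := complex.Re (\tr (A *m B)).

Definition kronI (m : nat) {n} (X : 'M[C]_n) : 'M[C]_(m * n) :=
  tensmx (1%:M : 'M[C]_m) X.
Definition ptr1 {m n} (X : 'M[C]_(m * n)) : 'M[C]_n :=
  \matrix_(i, j) \sum_(a < m) X (mxtens_index (a, i)) (mxtens_index (a, j)).

Variables NV NW : nat -> nat.
(** dimension of W_t (x) V_t (x) ... (x) W_1 (x) V_1 *)
Fixpoint dimD (t : nat) : nat :=
  if t is s.+1 then NW s.+1 * (NV s.+1 * dimD s) else 1%N.

(** Combs Chn_{~V}; c_0 := 1 (the 1x1 identity) encodes Tr_{W_1} c_1 = I_{V_1}. *)
Definition chn (T : nat) (c : 'M[C]_(dimD T)) : Prop :=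
  psd c /\
  exists ct : forall t, 'M[C]_(dimD t),
    [/\ ct T = c, ct 0%N = 1%:M,
        (forall t, (0 < t <= T)%N -> psd (ct t)) &
        (forall t, (t < T)%N ->
           @ptr1 (NW t.+1) (NV t.+1 * dimD t) (ct t.+1) = kronI (NV t.+1) (ct t))].

Definition linspan {n} (A : set 'M[C]_n) : set 'M[C]_n :=
  [set X | exists k (r : 'I_k -> R) (Y : 'I_k -> 'M[C]_n),
     (forall l, A (Y l)) /\ X = \sum_(l < k) (real_complex R (r l)) *: Y l].

(** S_G; tau u stands for tau_{u+1}, u = 0..T-1. *)
Definition SG (T : nat) : set 'M[C]_(dimD T) :=
  match T as T0 return set 'M[C]_(dimD T0) with
  | 0%N => set0
  | s.+1 => [set X | exists tau : forall u, 'M[C]_(NV u.+1 * dimD u),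
      [/\ (forall u, (u <= s)%N -> psd (tau u)),
          \tr (tau 0%N) = 1,
          (forall u, (u < s)%N ->
             @ptr1 (NV u.+2) (dimD u.+1) (tau u.+1) = kronI (NW u.+1) (tau u)) &
          X = kronI (NW s.+1) (tau s)]]
  end.

Variables (T M J : nat).
Local Notation N := (dimD T).
Local Notation tuple := ('I_M -> 'M[C]_N).

Definition CG : set tuple := [set Phi | forall m, psd (Phi m)].
Definition TG : set tuple := [set Phi | CG Phi /\ SG (\sum_(m < M) Phi m)].

(** topology: entrywise closure (all norms are equivalent in finite dimension) *)
Definition clos_mx (S : set 'M[C]_N) : set 'M[C]_N :=
  [set X | forall e : R, 0 < e -> exists Y, S Y /\
      forall i j, Normc.normc (X i j - Y i j) < e].
Definition clos (A : set tuple) : set tuple :=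
  [set Phi | forall e : R, 0 < e -> exists Psi, A Psi /\
      forall m i j, Normc.normc (Phi m i j - Psi m i j) < e].
Definition closed_mx (S : set 'M[C]_N) : Prop := clos_mx S `<=` S.
Definition closed_tu (A : set tuple) : Prop := clos A `<=` A.

Definition convex_mx (S : set 'M[C]_N) : Prop :=
  forall X Y (t : R), S X -> S Y -> 0 <= t <= 1 ->
    S (real_complex R t *: X + real_complex R (1 - t) *: Y).
Definition convex_tu (A : set tuple) : Prop :=
  forall Phi Psi (t : R), A Phi -> A Psi -> 0 <= t <= 1 ->
    A (fun m => real_complex R t *: Phi m + real_complex R (1 - t) *: Psi m).
Definition cone_tu (A : set tuple) : Prop :=
  forall Phi (a : R), A Phi -> 0 <= a -> A (fun m => real_complex R a *: Phi m).

Variables (c : 'I_M -> 'M[C]_N) (a : 'I_J -> 'I_M -> 'M[C]_N) (b : 'I_J -> R).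

Definition eta_j (j : 'I_J) (Phi : tuple) : R :=
  \sum_(m < M) hinner (Phi m) (a j m) - b j.
Definition Pobj (Phi : tuple) : R := \sum_(m < M) hinner (Phi m) (c m).
Definition Pfeas (Tt : set tuple) : set tuple :=
  [set Phi | Tt Phi /\ forall j, eta_j j Phi <= 0].
(** optimal value of (P) (= -oo when infeasible) *)
Definition Pval (Tt : set tuple) : \bar R :=
  ereal_sup [set (Pobj Phi)%:E | Phi in Pfeas Tt].

Definition dualcone (Cc : set tuple) : set tuple :=
  [set y | (forall m, herm (y m)) /\
     forall Phi, Cc Phi -> 0 <= \sum_(m < M) hinner (Phi m) (y m)].
Definition lambdaS (S : set 'M[C]_N) (chi : 'M[C]_N) : \bar R :=
  ereal_sup [set (hinner phi chi)%:E | phi in S].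
Definition zq (q : 'I_J -> R) (m : 'I_M) : 'M[C]_N :=
  c m - \sum_(j < J) real_complex R (q j) *: a j m.
Definition Dfeas (Cc : set tuple) : set ('M[C]_N * ('I_J -> R)) :=
  [set p | [/\ herm p.1, (forall j, 0 <= p.2 j) &
            dualcone Cc (fun m => p.1 - zq p.2 m)]].
Definition Dobj (S : set 'M[C]_N) (p : 'M[C]_N * ('I_J -> R)) : \bar R :=
  (lambdaS S p.1 + (\sum_(j < J) p.2 j * b j)%:E)%E.
(** optimal value of (D) (= +oo when infeasible) *)
Definition Dval (Cc : set tuple) (S : set 'M[C]_N) : \bar R :=
  ereal_inf [set Dobj S p | p in Dfeas Cc].
Definition Dopt (Cc : set tuple) (S : set 'M[C]_N) p : Prop :=
  Dfeas Cc p /\ Dobj S p = Dval Cc S.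

End QuantumOpt.

(* Main.v *)
(** Strong duality for each pair (P_i), (D_i) comes from separating
    (0, 0, v + e), where v is the optimal value of (P_i), from the convex set of
    attainable triples (sum_m Phi_m - phi, constraint values, objective).  That
    set need not be closed, but a sequence in it that approaches such a point is
    bounded (psd matrices are bounded by their trace), so a limit exists and is
    feasible by the closure assumption on P.  Given strong duality, (1), (2), (3)
    reduce to the chain
    Pval_1 = Dval_1 <= Dobj_1 p <= Dobj_2 p = Dval_2 = Pval_2.
    When S_2 = S_G, a second separation shows that every Hermitian chi is
    dominated by some chi' in Lin(Chn) with the same support function value on
    S_G; this turns an optimal solution of (D_2) into one with chi' in Lin(Chn),
    whose pairing with all of S_G is constant. *)
Require Import Defs.
From HB Require Import structures.
From mathcomp Require Import all_boot all_order all_algebra.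
From mathcomp Require Import boolp classical_sets reals constructive_ereal ereal.
From mathcomp Require Import filter topology normedtype sequences.
From mathcomp Require Import complex mxtens spectral ring lra.
Import Order.TTheory GRing.Theory Num.Theory numFieldNormedType.Exports.
Local Open Scope ring_scope.
Local Open Scope classical_set_scope.

Set Implicit Arguments.
Unset Strict Implicit.
Unset Printing Implicit Defensive.

(** * Separation in finite dimension *)

(** Each separation yields a uniform gap [d], and this gap makes the multiplier of the objective
    positive: were it zero, a feasible point would give [d <= 0]. The second separation rests on a
    polarity. A Hermitian operator obeying the linear comb constraints with root value [r] pairs to
    exactly [r] with every tester; conversely a psd operator orthogonal to the root-value-0 space
    and normalised on one comb is a tester. So a functional separating [chi] from everything
    dominated by operators of root value lambda_{S_G}(chi) would rescale to a tester on which [chi]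
    exceeds its support value. The implication from (3) to (1) passes through (4): pairing with an
    element of Lin(Chn) is constant on S_G, so its support function agrees on S_1 and S_2. Limits
    run along an ultrafilter on [nat], which treats all matrix entries at once. *)

Section Separation.
Context {R : realType}.
Implicit Types (I : finType).

Lemma ultra_nat : exists U : set_system nat, UltraFilter U /\ \oo `<=` U.
Proof.
have [U [UU sU]] := @ultraFilterLemma nat \oo eventually_filter.
by exists U.
Qed.

(** Compactness of [[- B, B]] gives a cluster point, and a cluster point of an ultrafilter is a
    limit because each set or its complement belongs to it. *)
Lemma ultra_bounded_cvg (U : set_system nat) (UU : UltraFilter U) (f : nat -> R)
  (B : R) : (forall n, `|f n| <= B) -> exists l : R, f n @[n --> U] --> l.
Proof.
move=> fB.
have PU : ProperFilter U by exact: ultra_proper.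
have fin : (f @ U) `[- B, B]%classic.
  by apply: nearW => n /=; rewrite in_itv /= -ler_norml.
have [l [_ cl]] := @segment_compact R (- B) B (f @ U) _ fin.
exists l => V Vl /=.
have [//|UnV] := in_ultra_setVsetC (f @^-1` V) UU.
have [x [Vx nVx]] := cl (~` V) V UnV Vl.
by [].
Qed.

Lemma cvg_fsum I (r : seq I) (U : set_system nat) (FU : Filter U)
  (f : I -> nat -> R) (l : I -> R) : (forall i, f i n @[n --> U] --> l i) ->
  \sum_(i <- r) f i n @[n --> U] --> \sum_(i <- r) l i.
Proof.
move=> fl; elim: r => [|i r IH].
  by rewrite big_nil; under eq_fun do rewrite big_nil; exact: cvg_cst.
by rewrite big_cons; under eq_fun do rewrite big_cons; exact: cvgD.
Qed.

(* The minimiser of the distance is produced as an ultralimit of a minimising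
   sequence, so no closedness of [K] is needed. *)
Lemma separation I (K : set (I -> R)) (x : I -> R) :
  (forall k k' (t : R), K k -> K k' -> 0 <= t <= 1 ->
     K (fun i => t * k i + (1 - t) * k' i)) ->
  (forall e, 0 < e -> exists2 k, K k & \sum_i (k i - x i) ^+ 2 < e) \/
  exists y d, 0 < d /\
    forall k, K k -> \sum_i y i * k i + d <= \sum_i y i * x i.
Proof.
move=> Kcvx.
have [h|/existsNP[e /not_implyP[e0 hne]]] :=
  pselect (forall e, 0 < e -> exists2 k, K k & \sum_i (k i - x i) ^+ 2 < e).
  by left.
right.
have he k : K k -> e <= \sum_i (k i - x i) ^+ 2.
  by move=> Kk; rewrite leNgt; apply/negP => lt; apply: hne; exists k.
have [[k0 Kk0]|K0] := pselect (K !=set0); last first.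
  exists (fun=> 0), 1; split => // k Kk; exfalso; apply: K0; by exists k.
pose D := [set \sum_i (k i - x i) ^+ 2 | k in K].
have Dinf : has_inf D.
  split; first by exists (\sum_i (k0 i - x i) ^+ 2), k0.
  by exists e => _ [k Kk <-]; exact: he.
pose d := inf D.
have dle k : K k -> d <= \sum_i (k i - x i) ^+ 2.
  by move=> Kk; apply: ge_inf; [case: Dinf|exists k].
have d0 : 0 < d.
  apply: lt_le_trans e0 _; apply: lb_le_inf; first by case: Dinf.
  by move=> _ [k Kk <-]; exact: he.
have /choice[ks hks] : forall n : nat, exists k, K k /\
    \sum_i (k i - x i) ^+ 2 < d + n.+1%:R^-1.
  move=> n; have := @inf_adherent _ D n.+1%:R^-1.
  rewrite invr_gt0 ltr0n => /(_ isT Dinf)[_ [k Kk <-] lt].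
  by exists k.
have [U [UU sU]] := ultra_nat.
have PU : ProperFilter U by exact: ultra_proper.
(* Squared distances along the sequence are at most [d + 1], and [d + 2] has a larger square. *)
have bnd i n : `|ks n i - x i| <= d + 2.
  have [_ lt] := hks n.
  have : (ks n i - x i) ^+ 2 <= (d + 2) ^+ 2.
    apply: (@le_trans _ _ (d + 1)); last by nra.
    apply: (@le_trans _ _ (\sum_i (ks n i - x i) ^+ 2)).
      by rewrite (bigD1 i) //= lerDl sumr_ge0 // => j _; exact: sqr_ge0.
    apply: (le_trans (ltW lt)); rewrite lerD2l.
    by rewrite invf_le1 ?ltr0n // ler1n.
  by rewrite -[X in X <= _]real_normK ?num_real// ler_sqr ?nnegrE//; lra.
have /choice[u hu] : forall i, exists l : R, (ks n i - x i) @[n --> U] --> l.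
  by move=> i; exact: (ultra_bounded_cvg UU (bnd i)).
have ud : \sum_i u i ^+ 2 <= d.
  have c1 : \sum_i (ks n i - x i) ^+ 2 @[n --> U] --> \sum_i u i ^+ 2.
    by apply: cvg_fsum => i; rewrite expr2; under eq_fun do rewrite expr2; apply: cvgM.
  have c2 : (d + n.+1%:R^-1) @[n --> U] --> d + 0.
    apply: cvgD; first exact: cvg_cst.
    by apply: cvg_trans (@cvg_harmonic R) => V; exact: sU.
  rewrite -[leRHS]addr0; apply: ler_cvg_to c1 c2 _.
  by apply: nearW => n; have [_ /ltW] := hks n.
exists (fun i => - u i), d; split => // k Kk.
pose w i := k i - x i.
suff H : d <= \sum_i u i * w i.
  have E : \sum_i u i * w i = \sum_i - u i * x i - \sum_i - u i * k i.
    by rewrite -sumrB; apply: eq_bigr => i _; rewrite /w; ring.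
  lra.
(* [u] is only a limit of points of [K] shifted by [- x], so the distance bound on convex
   combinations is passed to the limit. *)
have key (t : R) : 0 < t -> t <= 1 -> 
   d <= \sum_i (t * w i + (1 - t) * u i) ^+ 2.
  move=> t0 t1.
  have c1 : \sum_i (t * w i + (1 - t) * (ks n i - x i)) ^+ 2 @[n --> U]
      --> \sum_i (t * w i + (1 - t) * u i) ^+ 2.
    apply: cvg_fsum => i; rewrite expr2; under eq_fun do rewrite expr2.
    by apply: cvgM; apply: cvgD; [exact: cvg_cst| |exact: cvg_cst|];
      (apply: cvgM; first exact: cvg_cst).
  apply: ler_cvg_to (cvg_cst d) c1 _; apply: nearW => n.
  have [Kn _] := hks n.
  have t01 : 0 <= t <= 1 by rewrite (ltW t0) t1.
  apply: le_trans (dle _ (Kcvx _ _ t Kk Kn t01)) _.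
  rewrite le_eqVlt; apply/orP; left; apply/eqP.
  by apply: eq_bigr => i _; rewrite /w; congr (_ ^+ 2); ring.
set s := \sum_i u i * w i.
set ww := \sum_i w i ^+ 2.
have E t : \sum_i (t * w i + (1 - t) * u i) ^+ 2
    = t ^+ 2 * ww + 2 * t * (1 - t) * s + (1 - t) ^+ 2 * \sum_i u i ^+ 2.
  rewrite /ww /s !mulr_sumr -!big_split /=; apply: eq_bigr => i _; ring.
(* Bounding the square norm of [u] by [d] and dividing by [t] leaves, as [t] tends to 0, exactly
   [d <= s]; the rest picks a [t] small enough for a contradiction. *)
have key2 t : 0 < t -> t <= 1 -> d * (2 - t) <= t * ww + 2 * (1 - t) * s.
  move=> t0 t1; rewrite -(ler_pM2l t0).
  have := key t t0 t1; rewrite E; set v := \sum_i u i ^+ 2 in ud * => h.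
  have : 0 <= (1 - t) ^+ 2 * (d - v) by rewrite mulr_ge0 ?sqr_ge0// subr_ge0.
  by clear -h => h'; nra.
rewrite leNgt; apply/negP => lt.
have ww0 : 0 <= ww by apply: sumr_ge0 => i _; exact: sqr_ge0.
(* [2 |s|] replaces [- 2 s] in the critical [t], to keep the denominator positive. *)
pose B := d + ww + 2 * `|s| + (d - s).
have s1 : s <= `|s| by exact: ler_norm.
have s2 : - s <= `|s| by rewrite -normrN ler_norm.
have B0 : 0 < B by rewrite /B; lra.
pose t := (d - s) / B.
have t0 : 0 < t by rewrite divr_gt0 //; lra.
have t1 : t <= 1 by rewrite ler_pdivrMr // /B; lra.
have tB : t * B = d - s by rewrite /t divfK // gt_eqF.
have := key2 t t0 t1; move: tB; rewrite /B; nra.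
Qed.
End Separation.


(** * Hermitian and positive semidefinite matrices *)

Section HermitianMatrices.
Context {R : realType}.
Local Notation C := (R[i]).
Local Notation "x %:C" := (real_complex R x) : ring_scope.
Implicit Types (n : nat).

Lemma ReD (x y : C) : complex.Re (x + y) = complex.Re x + complex.Re y.
Proof. by case: x; case: y. Qed.
Lemma ImD (x y : C) : complex.Im (x + y) = complex.Im x + complex.Im y.
Proof. by case: x; case: y. Qed.
Lemma ReZ (r : R) (x : C) : complex.Re (r%:C * x) = r * complex.Re x.
Proof. by case: x => a b /=; rewrite mul0r subr0. Qed.
Lemma Re_sum (I : Type) (r : seq I) (P : pred I) (F : I -> C) :
  complex.Re (\sum_(i <- r | P i) F i) = \sum_(i <- r | P i) complex.Re (F i).
Proof. exact: (big_morph _ ReD). Qed.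
Lemma normc_le (z : C) :
  Normc.normc z <= `|complex.Re z| + `|complex.Im z|.
Proof.
case: z => a b /=; rewrite -(ler_pXn2r (n := 2)) ?nnegrE ?sqrtr_ge0 ?addr_ge0//.
rewrite sqr_sqrtr ?addr_ge0 ?sqr_ge0// sqrrD !real_normK ?num_real//.
by rewrite -addrA lerD2l lerDr mulrn_wge0 // mulr_ge0.
Qed.
Lemma Re_le_normc (z : C) : `|complex.Re z| <= Normc.normc z.
Proof.
by case: z => a b /=; rewrite -sqrtr_sqr ler_wsqrtr // lerDl sqr_ge0.
Qed.
Lemma Im_le_normc (z : C) : `|complex.Im z| <= Normc.normc z.
Proof.
by case: z => a b /=; rewrite -sqrtr_sqr ler_wsqrtr // lerDr sqr_ge0.
Qed.

Lemma hinnerDl n (A B X : 'M[C]_n) : hinner (A + B) X = hinner A X + hinner B X.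
Proof. by rewrite /hinner mulmxDl mxtraceD ReD. Qed.
Lemma hinnerC n (A B : 'M[C]_n) : hinner A B = hinner B A.
Proof. by rewrite /hinner mxtrace_mulC. Qed.
Lemma hinnerDr n (A B X : 'M[C]_n) : hinner X (A + B) = hinner X A + hinner X B.
Proof. by rewrite hinnerC hinnerDl !(hinnerC X). Qed.
Lemma hinnerZl n r (A X : 'M[C]_n) : hinner (r%:C *: A) X = r * hinner A X.
Proof. by rewrite /hinner -scalemxAl mxtraceZ ReZ. Qed.
Lemma hinnerZr n r (A X : 'M[C]_n) : hinner X (r%:C *: A) = r * hinner X A.
Proof. by rewrite hinnerC hinnerZl hinnerC. Qed.
Lemma hinner0l n (X : 'M[C]_n) : hinner 0 X = 0.
Proof. by rewrite /hinner mul0mx mxtrace0. Qed.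
Lemma hinner0r n (X : 'M[C]_n) : hinner X 0 = 0.
Proof. by rewrite hinnerC hinner0l. Qed.
Lemma hinnerNl n (A X : 'M[C]_n) : hinner (- A) X = - hinner A X.
Proof.
by apply/eqP; rewrite -subr_eq0 opprK -hinnerDl addNr hinner0l.
Qed.
Lemma hinnerNr n (A X : 'M[C]_n) : hinner X (- A) = - hinner X A.
Proof. by rewrite hinnerC hinnerNl hinnerC. Qed.
Lemma hinnerBl n (A B X : 'M[C]_n) : hinner (A - B) X = hinner A X - hinner B X.
Proof. by rewrite hinnerDl hinnerNl. Qed.
Lemma hinnerBr n (A B X : 'M[C]_n) : hinner X (A - B) = hinner X A - hinner X B.
Proof. by rewrite hinnerDr hinnerNr. Qed.
Lemma hinner_suml n (I : Type) (r : seq I) (F : I -> 'M[C]_n) X :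
  hinner (\sum_(i <- r) F i) X = \sum_(i <- r) hinner (F i) X.
Proof.
apply: (big_morph (fun A => hinner A X)); last exact: hinner0l.
by move=> A B; exact: hinnerDl.
Qed.
Lemma hinner_sumr n (I : Type) (r : seq I) (F : I -> 'M[C]_n) X :
  hinner X (\sum_(i <- r) F i) = \sum_(i <- r) hinner X (F i).
Proof. by rewrite hinnerC hinner_suml; apply: eq_bigr => i _; exact: hinnerC. Qed.

Lemma hinnerE n (X A : 'M[C]_n) : hinner X A =
  \sum_i \sum_j (complex.Re (X i j) * complex.Re (A j i)
                 - complex.Im (X i j) * complex.Im (A j i)).
Proof.
rewrite /hinner /mxtrace Re_sum; apply: eq_bigr => i _.
rewrite mxE Re_sum; apply: eq_bigr => j _.
by case: (X i j) => x y; case: (A j i) => z t.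
Qed.

Lemma adjK n (A : 'M[C]_n) : adj (adj A) = A.
Proof. by apply/matrixP => i j; rewrite !mxE conjcK. Qed.
Lemma adjD n (A B : 'M[C]_n) : adj (A + B) = adj A + adj B.
Proof. by apply/matrixP => i j; rewrite !mxE rmorphD. Qed.
Lemma adj0 n : adj (0 : 'M[C]_n) = 0.
Proof. by apply/matrixP => i j; rewrite !mxE rmorph0. Qed.
Lemma adjZ n r (A : 'M[C]_n) : adj (r%:C *: A) = r%:C *: adj A.
Proof. by apply/matrixP => i j; rewrite !mxE rmorphM /= oppr0. Qed.
Lemma adjM n (A B : 'M[C]_n) : adj (A *m B) = adj B *m adj A.
Proof. by rewrite /adj trmx_mul map_mxM. Qed.
Lemma hinner_adj n (A B : 'M[C]_n) : hinner (adj A) (adj B) = hinner A B.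
Proof.
rewrite hinnerC /hinner -adjM /adj.
have -> : \tr (map_mx (@conjc R) (A *m B)^T) = conjc (\tr (A *m B)).
  by rewrite /mxtrace rmorph_sum; apply: eq_bigr => i _; rewrite !mxE.
by case: (\tr _).
Qed.

Lemma herm0 n : herm (0 : 'M[C]_n).
Proof. by rewrite /herm adj0. Qed.
Lemma hermD n (A B : 'M[C]_n) : herm A -> herm B -> herm (A + B).
Proof. by rewrite /herm adjD => {1}-> {1}->. Qed.
Lemma hermZ n r (A : 'M[C]_n) : herm A -> herm (r%:C *: A).
Proof. by rewrite /herm adjZ => {1}->. Qed.
Lemma hermN n (A : 'M[C]_n) : herm A -> herm (- A).
Proof. by move=> /(hermZ (-1)); rewrite rmorphN1 scaleN1r. Qed.
Lemma hermB n (A B : 'M[C]_n) : herm A -> herm B -> herm (A - B).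
Proof. by move=> hA /hermN; exact: hermD. Qed.
Lemma herm_sum n (I : Type) (r : seq I) (F : I -> 'M[C]_n) :
  (forall i, herm (F i)) -> herm (\sum_(i <- r) F i).
Proof.
by move=> hF; elim/big_ind: _ => //; [exact: herm0|exact: hermD].
Qed.
Lemma herm1 n : herm (1%:M : 'M[C]_n).
Proof.
by rewrite /herm /adj trmx1 map_mx1.
Qed.

Lemma hermP n (A : 'M[C]_n) : (herm A) <-> forall i j, A i j = conjc (A j i).
Proof.
split=> [h i j|h]; first by rewrite {1}h !mxE.
by apply/matrixP => i j; rewrite !mxE.
Qed.

(** A separating functional is an arbitrary complex matrix, whereas dual variables must be
    Hermitian; this projection keeps all pairings with Hermitian matrices. *)
Definition hpart n (A : 'M[C]_n) : 'M[C]_n := (2^-1)%:C *: (A + adj A).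
Lemma herm_hpart n (A : 'M[C]_n) : herm (hpart A).
Proof. by apply: hermZ; rewrite /herm adjD adjK addrC. Qed.
Lemma hinner_hpart n (A X : 'M[C]_n) : herm X -> hinner X (hpart A) = hinner X A.
Proof.
move=> hX; rewrite /hpart hinnerZr hinnerDr {2}hX hinner_adj.
by lra.
Qed.

(** For Hermitian [A] the pairing with itself is the sum of the squared moduli of its entries. *)
Lemma hinner_self_eq0 n (A : 'M[C]_n) : herm A -> hinner A A = 0 -> A = 0.
Proof.
move=> hA; rewrite hinnerE => /eqP.
have E i j : complex.Re (A i j) * complex.Re (A j i)
           - complex.Im (A i j) * complex.Im (A j i)
   = complex.Re (A i j) ^+ 2 + complex.Im (A i j) ^+ 2.
  rewrite ((hermP A).1 hA j i); case: (A i j) => x y /=; ring.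
rewrite psumr_eq0 => [/allP h|i _]; last first.
  by apply: sumr_ge0 => j _; rewrite E addr_ge0 ?sqr_ge0.
apply/matrixP => i j; rewrite mxE.
have := h i (mem_index_enum _); rewrite psumr_eq0 => [/allP h'|k _]; last first.
  by rewrite E addr_ge0 ?sqr_ge0.
have := h' j (mem_index_enum _); rewrite /= E paddr_eq0 ?sqr_ge0// !sqrf_eq0.
by case: (A i j) => x y /= /andP[/eqP-> /eqP->].
Qed.

(* [mxcvg U X L] is weak convergence, which is entrywise convergence. *)
Definition mxcvg n (U : set_system nat) (X : nat -> 'M[C]_n) (L : 'M[C]_n) :=
  forall A, hinner (X k) A @[k --> U] --> (hinner L A : R).

Lemma mxcvg_entries n (U : set_system nat) (FU : Filter U) (X : nat -> 'M[C]_n)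
    (L : 'M[C]_n) :
  (forall i j, complex.Re (X k i j) @[k --> U] --> (complex.Re (L i j) : R)) ->
  (forall i j, complex.Im (X k i j) @[k --> U] --> (complex.Im (L i j) : R)) ->
  mxcvg U X L.
Proof.
move=> hR hI A; rewrite hinnerE; under eq_fun do rewrite hinnerE.
apply: cvg_fsum => i; apply: cvg_fsum => j.
by apply: cvgB; (apply: cvgM; last exact: cvg_cst).
Qed.

Lemma mxcvg_bounded n (U : set_system nat) (UU : UltraFilter U) (X : nat -> 'M[C]_n) B :
  (forall k i j, `|complex.Re (X k i j)| <= B /\ `|complex.Im (X k i j)| <= B) ->
  exists L, mxcvg U X L.
Proof.
move=> XB.
have /choice[r hr] : forall ij : 'I_n * 'I_n, exists l : R,
    complex.Re (X k ij.1 ij.2) @[k --> U] --> l.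
  by move=> ij; apply: (@ultra_bounded_cvg _ _ _ _ B) => k; case: (XB k ij.1 ij.2).
have /choice[s hs] : forall ij : 'I_n * 'I_n, exists l : R,
    complex.Im (X k ij.1 ij.2) @[k --> U] --> l.
  by move=> ij; apply: (@ultra_bounded_cvg _ _ _ _ B) => k; case: (XB k ij.1 ij.2).
exists (\matrix_(i, j) (Complex (r (i, j)) (s (i, j)))).
by apply: mxcvg_entries => i j; rewrite mxE; [exact: (hr (i, j))|exact: (hs (i, j))].
Qed.

Lemma hinner_deltaR n (X : 'M[C]_n) i j :
  hinner X (delta_mx j i) = complex.Re (X i j).
Proof.
rewrite hinnerE (bigD1 i) //= (bigD1 j) //= mxE !eqxx /= mulr1 mulr0 subr0.
rewrite big1 ?addr0 => [|k /negPf kj]; last by rewrite mxE kj /= !mulr0 subr0.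
rewrite big1 ?addr0 // => k /negPf ki; apply: big1 => l _.
by rewrite mxE ki andbF /= !mulr0 subr0.
Qed.
Lemma hinner_deltaI n (X : 'M[C]_n) i j :
  hinner X (- 'i%C *: delta_mx j i) = complex.Im (X i j).
Proof.
rewrite hinnerE (bigD1 i) //= (bigD1 j) //= !mxE !eqxx /=.
rewrite big1 ?addr0 => [|k /negPf kj]; last by rewrite !mxE kj /=; ring.
rewrite big1 => [|k /negPf ki]; first by ring.
by apply: big1 => l _; rewrite !mxE ki andbF /=; ring.
Qed.

(** Testing against [delta_mx j i] and its multiple by [- 'i] recovers both parts of each entry;
    there are finitely many entries, so one set of the filter serves all. This is the form that
    [clos] asks for. *)
Lemma mxcvg_near n (U : set_system nat) (FU : Filter U) (X : nat -> 'M[C]_n)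
    (L : 'M[C]_n) :
  mxcvg U X L -> forall e : R, 0 < e ->
  U [set k | forall i j, Normc.normc (X k i j - L i j) < e].
Proof.
move=> XL e e0.
have e2 : 0 < e / 2 by rewrite divr_gt0.
have H (i j : 'I_n) : U [set k | Normc.normc (X k i j - L i j) < e].
  have h1 := XL (delta_mx j i); have h2 := XL (- 'i%C *: delta_mx j i).
  move/cvgrPdist_lt/(_ _ e2): h1 => h1; move/cvgrPdist_lt/(_ _ e2): h2 => h2.
  apply: filterS2 h1 h2 => k /=; rewrite !hinner_deltaR !hinner_deltaI.
  rewrite distrC => h1; rewrite distrC => h2.
  apply: le_lt_trans (normc_le _) _.
  rewrite ReD ImD (_ : complex.Re (- L i j) = - complex.Re (L i j)); last by case: (L i j).
  rewrite (_ : complex.Im (- L i j) = - complex.Im (L i j)); last by case: (L i j).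
  by rewrite (splitr e) ltrD.
have H' (i : 'I_n) : U [set k | forall j, Normc.normc (X k i j - L i j) < e].
  by apply: filterS (@filter_forall _ _ _ _ FU (H i)) => k h j; exact: h.
by apply: filterS (@filter_forall _ _ _ _ FU H') => k h i; exact: h.
Qed.
End HermitianMatrices.


(** * Positive semidefinite matrices: spectral form and trace bounds *)

Section Positivity.
Context {R : realType}.
Local Notation C := (R[i]).
Local Notation "x %:C" := (real_complex R x) : ring_scope.
Implicit Types (n m : nat).

Definition rank1 n (v : 'cV[C]_n) : 'M[C]_n := v *m (map_mx (@conjc R) v)^T.

Lemma hinner_deltaZ n (X : 'M[C]_n) (z : C) i j :
  hinner X (z *: delta_mx j i) = complex.Re (z * X i j).
Proof.
rewrite hinnerE (bigD1 i) //= (bigD1 j) //= !mxE !eqxx /=.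
rewrite big1 ?addr0 => [|k /negPf kj]; last by rewrite !mxE kj /= mulr0 /=; ring.
rewrite big1 => [|k /negPf ki].
  by rewrite mulr1; case: z => a b; case: (X i j) => x y /=; ring.
by apply: big1 => l _; rewrite !mxE ki andbF /= mulr0 /=; ring.
Qed.

Lemma herm_rank1 n (v : 'cV[C]_n) : herm (rank1 v).
Proof.
apply/hermP => i j; rewrite !mxE rmorph_sum; apply: eq_bigr => k _.
by rewrite !mxE rmorphM /= conjcK mulrC.
Qed.

Lemma qformE n (A : 'M[C]_n) (v : 'cV[C]_n) :
  complex.Re (((map_mx (@conjc R) v)^T *m A *m v) 0 0) = hinner A (rank1 v).
Proof.
rewrite /hinner /rank1 mulmxA mxtrace_mulC mulmxA /mxtrace.
by rewrite big_ord_recl big_ord0 addr0.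
Qed.

(** Nonnegativity in the complex order also demands a zero imaginary part, which a Hermitian matrix
    gives for free; positivity thus becomes a real condition on pairings. *)
Lemma psdP n (A : 'M[C]_n) :
  psd A <-> herm A /\ forall v, 0 <= hinner A (rank1 v).
Proof.
split=> -[hA h]; split=> // v.
  by have := h v; rewrite lecE => /andP[_]; rewrite qformE.
rewrite lecE qformE h andbT /=.
set z := _ 0 0.
have : z = conjc z.
  rewrite /z; set B := _ *m _.
  have E : B = (map_mx (@conjc R) B)^T.
    rewrite /B !map_mxM !trmx_mul.
    have -> : (map_mx (@conjc R) (map_mx (@conjc R) v)^T)^T = v.
      by apply/matrixP => i j; rewrite !mxE conjcK.
    have -> : (map_mx (@conjc R) A)^T = A.
      by apply/matrixP => i j; rewrite !mxE -((hermP A).1 hA).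
    by rewrite mulmxA.
  by rewrite {1}E !mxE.
by case: z => x y [] /eqP; rewrite -subr_eq0 opprK -mulr2n mulrn_eq0.
Qed.

Lemma psd_herm n (A : 'M[C]_n) : psd A -> herm A.
Proof. by case. Qed.
Lemma psd_rank1_ge0 n (A : 'M[C]_n) v : psd A -> 0 <= hinner A (rank1 v).
Proof. by case/psdP => _; apply. Qed.
Lemma psd0 n : psd (0 : 'M[C]_n).
Proof. by apply/psdP; split=> [|v]; [exact: herm0|rewrite hinner0l]. Qed.
Lemma psdD n (A B : 'M[C]_n) : psd A -> psd B -> psd (A + B).
Proof.
move=> /psdP[hA pA] /psdP[hB pB]; apply/psdP; split=> [|v]; first exact: hermD.
by rewrite hinnerDl addr_ge0.
Qed.
Lemma psdZ n r (A : 'M[C]_n) : 0 <= r -> psd A -> psd (r%:C *: A).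
Proof.
move=> r0 /psdP[hA pA]; apply/psdP; split=> [|v]; first exact: hermZ.
by rewrite hinnerZl mulr_ge0.
Qed.
Lemma psd_sum n (I : Type) (r : seq I) (F : I -> 'M[C]_n) :
  (forall i, psd (F i)) -> psd (\sum_(i <- r) F i).
Proof. by move=> h; elim/big_ind: _ => //; [exact: psd0|exact: psdD]. Qed.

Lemma psd_rank1 n (v : 'cV[C]_n) : psd (rank1 v).
Proof.
apply/psdP; split=> [|w]; first exact: herm_rank1.
rewrite /hinner /rank1 -mulmxA mxtrace_mulC -!mulmxA mulmxA.
set x := _ *m w; set y := _ *m v.
have -> : x = (map_mx (@conjc R) y)^T.
  rewrite /x /y.
  apply/matrixP => i j; rewrite !mxE rmorph_sum; apply: eq_bigr => k _.
  by rewrite !mxE rmorphM /= conjcK mulrC.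
rewrite /mxtrace big_ord_recl big_ord0 addr0 mxE big_ord_recl big_ord0 addr0.
by rewrite !mxE; case: (\sum_j _) => a b /=; nra.
Qed.

Lemma psd_spectral n (B : 'M[C]_n) : psd B -> exists (d : 'I_n -> R) (v : 'I_n -> 'cV[C]_n),
  (forall k, 0 <= d k) /\ B = \sum_k (d k)%:C *: rank1 (v k).
Proof.
move=> [hB pB].
have nB : B \is normalmx.
  apply/normalmxP.
  have E : map_mx Num.conj B^T = B by exact: (esym hB).
  by rewrite E.
have /orthomx_spectralP := nB.
set P := spectralmx B; set D := spectral_diag B => EB.
have PU : P \is unitarymx := spectral_unitarymx B.
rewrite (invmx_unitary PU) in EB.
pose v k : 'cV[C]_n := (map_mx (@conjc R) (row k P))^T.
have E : B = \sum_k D 0 k *: rank1 (v k).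
  rewrite {1}EB; apply/matrixP => i j; rewrite !mxE summxE.
  apply: eq_bigr => k _; rewrite mul_mx_diag !mxE big_ord_recl big_ord0 addr0.
  by rewrite !mxE conjcK -mulrA mulrCA.
(* Each eigenvalue is the quadratic form at its eigenvector, hence nonnegative. *)
have ED k : D 0 k = ((map_mx (@conjc R) (v k))^T *m B *m v k) 0 0.
  have PP := unitarymxP PU.
  have -> : (map_mx (@conjc R) (v k))^T = row k P.
    by apply/matrixP => i j; rewrite !mxE conjcK.
  have -> : v k = col k (map_mx Num.conj P^T).
    by apply/matrixP => i j; rewrite !mxE.
  have -> : row k P *m B *m col k (map_mx Num.conj P^T)
     = row k (P *m B *m map_mx Num.conj P^T) *m delta_mx k 0.
    by rewrite !row_mul colE mulmxA.
  rewrite EB !mulmxA PP mul1mx -mulmxA PP mulmx1 -colE !mxE eqxx mulr1n.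
  by [].
have D0 k : 0 <= D 0 k by rewrite ED; exact: pB.
exists (fun k => complex.Re (D 0 k)), v; split=> [k|].
  by have := D0 k; rewrite lecE => /andP[].
rewrite {1}E; apply: eq_bigr => k _; congr (_ *: _).
have := D0 k; rewrite lecE => /andP[/eqP /=].
by case: (D 0 k) => a b /= ->.
Qed.

Lemma psd_hinner_ge0 n (A B : 'M[C]_n) : psd A -> psd B -> 0 <= hinner A B.
Proof.
move=> pA /psd_spectral[d [v [d0 ->]]]; rewrite hinner_sumr sumr_ge0 // => k _.
by rewrite hinnerZr mulr_ge0 // psd_rank1_ge0.
Qed.

Lemma psd1 n : psd (1%:M : 'M[C]_n).
Proof.
have -> : 1%:M = \sum_(k < n) rank1 (delta_mx k 0 : 'cV[C]_n).
  apply/matrixP => i j; rewrite summxE (bigD1 i) //= big1 ?addr0 => [|k ki].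
    by rewrite !mxE big_ord_recl big_ord0 !mxE !eqxx /= !andbT addr0 mul1r;
      rewrite eq_sym; case: eqP => _ /=; rewrite ?oppr0.
  by rewrite !mxE big_ord_recl big_ord0 !mxE eq_sym (negPf ki) mul0r addr0.
by apply: psd_sum => k; exact: psd_rank1.
Qed.

Lemma psd_diag_ge0 n (A : 'M[C]_n) i : psd A -> 0 <= complex.Re (A i i).
Proof.
move=> pA; rewrite -hinner_deltaR.
have -> : delta_mx i i = rank1 (delta_mx i 0 : 'cV[C]_n).
  rewrite /rank1 (_ : (map_mx _ _)^T = delta_mx 0 i) ?mul_delta_mx//.
  by apply/matrixP => k l; rewrite !mxE andbC; case: (_ && _); rewrite /= ?oppr0.
exact: psd_rank1_ge0.
Qed.

Lemma hinner1 n (A : 'M[C]_n) : hinner A 1%:M = \sum_i complex.Re (A i i).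
Proof. by rewrite /hinner mulmx1 Re_sum. Qed.

Lemma psd_diag_le n (A : 'M[C]_n) i : psd A -> complex.Re (A i i) <= hinner A 1%:M.
Proof.
move=> pA; rewrite hinner1 (bigD1 i) //= lerDl sumr_ge0 // => j _.
exact: psd_diag_ge0.
Qed.

(** The quadratic form at e_j + conj(s) e_i is A_ii + A_jj + 2 Re(s A_ij), and each diagonal entry
    is at most the trace. *)
Lemma psd_offdiag n (A : 'M[C]_n) (s : C) i j : psd A -> Normc.normc s = 1 ->
  - complex.Re (s * A i j) <= hinner A 1%:M.
Proof.
move=> pA s1.
have ss : s * conjc s = 1.
  by rewrite -sqr_normc normc_def; move: s1; case: (s) => x y /= ->; rewrite expr1n.
pose v : 'cV[C]_n := delta_mx j 0 + conjc s *: delta_mx i 0.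
have cd (k : 'I_n) : (map_mx (@conjc R) (delta_mx k (0:'I_1)))^T = delta_mx 0 k.
  by apply/matrixP => p q; rewrite !mxE andbC; case: (_ && _); rewrite /= ?oppr0.
have Ev : rank1 v = 1 *: delta_mx j j + s *: delta_mx j i
                    + (conjc s *: delta_mx i j + 1 *: delta_mx i i).
  rewrite /rank1 /v map_mxD map_mxZ /= conjcK linearD /= linearZ /= !cd.
  rewrite mulmxDl !mulmxDr -!scalemxAl -!scalemxAr !mul_delta_mx scalerA.
  by rewrite [conjc s * s]mulrC ss !scale1r.
have := psd_rank1_ge0 v pA; rewrite Ev !hinnerDr !hinner_deltaZ !mul1r.
have -> : complex.Re (conjc s * A j i) = complex.Re (s * A i j).
  by rewrite ((hermP A).1 (psd_herm pA) j i); case: (s) => a b;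
    case: (A i j) => x y /=; ring.
have := psd_diag_le i pA; have := psd_diag_le j pA; lra.
Qed.

(** Letting [s] run through the four units 1, -1, i, -i bounds both parts of an entry from both
    sides. *)
Lemma psd_bounded n (A : 'M[C]_n) i j : psd A ->
  `|complex.Re (A i j)| <= hinner A 1%:M /\ `|complex.Im (A i j)| <= hinner A 1%:M.
Proof.
move=> pA.
have N1 : Normc.normc (1 : C) = 1 by rewrite /= expr0n expr1n /= addr0 sqrtr1.
have Ni : Normc.normc ('i%C : C) = 1 by rewrite /= expr0n expr1n /= add0r sqrtr1.
have := psd_offdiag i j pA N1.
have N1' : Normc.normc (-1 : C) = 1.
  by rewrite /= oppr0 sqrrN expr0n expr1n /= addr0 sqrtr1.
have Ni' : Normc.normc (- 'i%C : C) = 1.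
  by rewrite /= oppr0 sqrrN expr0n expr1n /= add0r sqrtr1.
have := psd_offdiag i j pA N1'.
have := psd_offdiag i j pA Ni.
have := psd_offdiag i j pA Ni'.
case: (A i j) => x y /= h1 h2 h3 h4.
by rewrite !ler_norml; split; apply/andP; split; lra.
Qed.

(** [K] is the entrywise l1 norm of [X]: each entry of [rank1 v] is bounded by its trace, so the
    form of [X] at [v] is at least [- K] times that trace. *)
Lemma herm_shift n (X : 'M[C]_n) : herm X ->
  exists2 K : R, 0 <= K & forall r, K <= r -> psd (X + r%:C *: 1%:M).
Proof.
move=> hX.
exists (\sum_i \sum_j (`|complex.Re (X i j)| + `|complex.Im (X i j)|)).
  by do 2!(apply: sumr_ge0 => ? _); rewrite addr_ge0.
move=> r Kr; apply/psdP; split=> [|v].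
  by apply: hermD => //; apply: hermZ; exact: herm1.
rewrite hinnerDl hinnerZl (hinnerC 1%:M).
have t0 : 0 <= hinner (rank1 v) 1%:M by apply: psd_hinner_ge0; [exact: psd_rank1|exact: psd1].
suff : - hinner X (rank1 v) <=
    \sum_i \sum_j (`|complex.Re (X i j)| + `|complex.Im (X i j)|) * hinner (rank1 v) 1%:M.
  under eq_bigr do rewrite -mulr_suml; rewrite -mulr_suml.
  by have := ler_wpM2r t0 Kr; lra.
rewrite hinnerE -sumrN; apply: ler_sum => i _; rewrite -sumrN; apply: ler_sum => j _.
have [] := psd_bounded j i (psd_rank1 v).
set t := hinner _ _ in t0 *; case: (rank1 v j i) => a b /=.
case: (X i j) => x y /= ha hb.
have := ler_wpM2l (normr_ge0 x) ha; have := ler_wpM2l (normr_ge0 y) hb.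
rewrite -!normrM.
have := ler_norm (- (x * a)); rewrite normrN; have := ler_norm (y * b); lra.
Qed.
End Positivity.


(** * Combs and testers *)

Section PartialTrace.
Context {R : realType}.
Local Notation C := (R[i]).
Local Notation "x %:C" := (real_complex R x) : ring_scope.
Implicit Types (n m : nat).

Lemma sum_mxtens (V : nmodType) m n (F : 'I_(m * n) -> V) :
  \sum_k F k = \sum_(a < m) \sum_(i < n) F (mxtens_index (a, i)).
Proof.
rewrite pair_big (reindex (@mxtens_index m n)) /=.
  by apply: eq_bigr => -[a i] _.
by exists (@mxtens_unindex m n) => k _; [exact: mxtens_indexK|exact: mxtens_unindexK].
Qed.

Lemma kronIE m n (X : 'M[C]_n) a i b j :
  kronI m X (mxtens_index (a, i)) (mxtens_index (b, j)) = (a == b)%:R * X i j.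
Proof. by rewrite /kronI tensmxE !mxE. Qed.

(** Tensoring with the identity and tracing out a factor are adjoint; nearly every later computation
    with combs and testers moves between the two through this fact. *)
Lemma mxtr_kronI m n (t : 'M[C]_n) (X : 'M[C]_(m * n)) :
  \tr (kronI m t *m X) = \tr (t *m ptr1 X).
Proof.
transitivity (\sum_(a < m) \sum_(i < n) \sum_(j < n)
    t i j * X (mxtens_index (a, j)) (mxtens_index (a, i))).
  rewrite /mxtrace sum_mxtens; apply: eq_bigr => a _; apply: eq_bigr => i _.
  rewrite mxE sum_mxtens (bigD1 a) //= [X in _ + X]big1 ?addr0.
    by apply: eq_bigr => j _; rewrite kronIE eqxx mul1r.
  move=> b ba; apply: big1 => j _.
  by rewrite kronIE eq_sym (negPf ba) !mul0r.
rewrite exchange_big /mxtrace; apply: eq_bigr => i _.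
rewrite mxE exchange_big; apply: eq_bigr => j _.
by rewrite mxE mulr_sumr.
Qed.

Lemma hinner_kronI m n (t : 'M[C]_n) (X : 'M[C]_(m * n)) :
  hinner (kronI m t) X = hinner t (ptr1 X).
Proof. by rewrite /hinner mxtr_kronI. Qed.
Lemma hinner_ptr1 m n (t : 'M[C]_n) (X : 'M[C]_(m * n)) :
  hinner (ptr1 X) t = hinner X (kronI m t).
Proof. by rewrite hinnerC -hinner_kronI hinnerC. Qed.

Lemma hinner_inj n (X Y : 'M[C]_n) : (forall A, hinner X A = hinner Y A) -> X = Y.
Proof.
move=> h; apply/matrixP => i j.
have := h (1 *: delta_mx j i); have := h (- 'i%C *: delta_mx j i).
rewrite !hinner_deltaI !hinner_deltaZ !mul1r.
by case: (X i j) => a b; case: (Y i j) => c d /= -> ->.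
Qed.

Lemma ptr1D m n (X Y : 'M[C]_(m * n)) : ptr1 (X + Y) = ptr1 X + ptr1 Y.
Proof. by apply: hinner_inj => A; rewrite hinnerDl !hinner_ptr1 hinnerDl. Qed.
Lemma ptr1Z m n r (X : 'M[C]_(m * n)) : ptr1 (r%:C *: X) = r%:C *: ptr1 X.
Proof. by apply: hinner_inj => A; rewrite hinnerZl !hinner_ptr1 hinnerZl. Qed.
Lemma kronID m n (X Y : 'M[C]_n) : kronI m (X + Y) = kronI m X + kronI m Y.
Proof. by apply: hinner_inj => A; rewrite hinnerDl !hinner_kronI hinnerDl. Qed.
Lemma kronIZ m n r (X : 'M[C]_n) : kronI m (r%:C *: X) = r%:C *: kronI m X.
Proof. by apply: hinner_inj => A; rewrite hinnerZl !hinner_kronI hinnerZl. Qed.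
Lemma kronI0 m n : kronI m (0 : 'M[C]_n) = 0.
Proof. by apply: hinner_inj => A; rewrite hinner_kronI !hinner0l. Qed.
Lemma kronI1 m n : kronI m (1%:M : 'M[C]_n) = 1%:M.
Proof.
apply/matrixP => k l; case: (mxtens_indexP k) => a i; case: (mxtens_indexP l) => b j.
rewrite kronIE !mxE (inj_eq (can_inj (@mxtens_indexK m n))) xpair_eqE.
by case: (a == b); case: (i == j); rewrite ?mul1r ?mul0r.
Qed.

Lemma ptr1_kronI m n (X : 'M[C]_n) : ptr1 (kronI m X) = (m%:R)%:C *: X.
Proof.
apply/matrixP => i j; rewrite !mxE.
under eq_bigr do rewrite kronIE eqxx mul1r.
by rewrite sumr_const card_ord rmorph_nat mulr_natl.
Qed.

Lemma herm_kronI m n (X : 'M[C]_n) : herm X -> herm (kronI m X).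
Proof.
move=> /hermP h; apply/hermP => k l.
case: (mxtens_indexP k) => a i; case: (mxtens_indexP l) => b j.
by rewrite !kronIE rmorphM /= -h eq_sym; case: eqP => _ /=; rewrite oppr0.
Qed.
Lemma herm_ptr1 m n (X : 'M[C]_(m * n)) : herm X -> herm (ptr1 X).
Proof.
move=> /hermP h; apply/hermP => i j; rewrite !mxE rmorph_sum.
by apply: eq_bigr => a _; rewrite /= -h.
Qed.

(** The vectors on the right are e_a tensor v. With adjointness this gives positivity of the partial
    trace. *)
Lemma kronI_rank1 m n (v : 'cV[C]_n) : kronI m (rank1 v) =
  \sum_(a < m) rank1 (\col_k (((mxtens_unindex k).1 == a)%:R * v (mxtens_unindex k).2 0)).
Proof.
apply/matrixP => k l; case: (mxtens_indexP k) => a i; case: (mxtens_indexP l) => b j.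
rewrite kronIE summxE (bigD1 a) // big1 ?addr0.
  rewrite !mxE !big_ord_recl !big_ord0 !addr0 !mxE !mxtens_indexK eqxx mul1r.
  rewrite rmorphM /= ?addr0 mulrCA eq_sym; congr (_ * (_ * _)).
  by case: eqP => _ /=; rewrite oppr0.
move=> d /andP[_ da]; rewrite !mxE big_ord_recl big_ord0 addr0 !mxE !mxtens_indexK.
by rewrite eq_sym (negPf da) !mul0r.
Qed.

Lemma psd_ptr1 m n (X : 'M[C]_(m * n)) : psd X -> psd (ptr1 X).
Proof.
move=> pX; apply/psdP; split=> [|v]; first exact/herm_ptr1/psd_herm.
rewrite hinner_ptr1 kronI_rank1 hinner_sumr sumr_ge0 // => a _.
exact: psd_rank1_ge0.
Qed.

Lemma mxcvg_unique n (U : set_system nat) (PU : ProperFilter U)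
  (X : nat -> 'M[C]_n) L L' : mxcvg U X L -> mxcvg U X L' -> L = L'.
Proof.
move=> h h'; apply: hinner_inj => A.
exact: (cvg_unique _ (h A) (h' A)).
Qed.

Lemma mxcvg_herm n (U : set_system nat) (PU : ProperFilter U)
  (X : nat -> 'M[C]_n) L : mxcvg U X L -> (forall k, herm (X k)) -> herm L.
Proof.
move=> XL hX; apply: (mxcvg_unique PU XL) => A.
rewrite -(adjK A) hinner_adj; under eq_fun do rewrite {1}hX hinner_adj.
exact: XL.
Qed.
End PartialTrace.

(** * Linear comb constraints and their pairing with testers *)

Section Combs.
Context {R : realType} (NV NW : nat -> nat).
Local Notation C := (R[i]).
Local Notation "x %:C" := (real_complex R x) : ring_scope.
Local Notation dim := (dimD NV NW).
Local Notation trW s := (@ptr1 R (NW s.+1) (NV s.+1 * dim s)).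
Local Notation trV s := (@ptr1 R (NV s.+1) (dim s)).

Unset Implicit Arguments.

(* The Hermitian operators satisfying the linear constraints of a comb, with
   the normalisation at the root relaxed to [r]. *)
Fixpoint lcomb (t : nat) (r : R) : 'M[C]_(dim t) -> Prop :=
  match t with
  | 0 => fun X => X = (r%:C)%:M
  | s.+1 => fun X => herm X /\
      exists Y, lcomb s r Y /\ trW s X = kronI (NV s.+1) Y
  end.

Fixpoint pcomb (t : nat) (r : R) : 'M[C]_(dim t) -> Prop :=
  match t with
  | 0 => fun X => X = (r%:C)%:M
  | s.+1 => fun X => psd X /\
      exists Y, pcomb s r Y /\ trW s X = kronI (NV s.+1) Y
  end.

(** Recursive form of S_G: the constraint on Tr_V of tau says that it is itself a tester one level
    down, and the 1x1 identity at the root encodes Tr tau_1 = 1. *)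
Fixpoint tester (t : nat) : 'M[C]_(dim t) -> Prop :=
  match t with
  | 0 => fun Y => Y = 1%:M
  | s.+1 => fun Y => exists tau,
      [/\ psd tau, Y = kronI (NW s.+1) tau & tester s (trV s tau)]
  end.

Set Implicit Arguments.

Lemma dim_gt0 s : (0 < dim s.+1)%N -> [/\ (0 < NW s.+1)%N, (0 < NV s.+1)%N & (0 < dim s)%N].
Proof. by rewrite /= !muln_gt0 => /andP[-> /andP[-> ->]]. Qed.

(** The root value is linear, so [lcomb t 0] is a linear space and each [lcomb t r] is parallel to
    it. *)
Lemma lcomb_comb t r r' x x' X X' : lcomb t r X -> lcomb t r' X' ->
  lcomb t (x * r + x' * r') (x%:C *: X + x'%:C *: X').
Proof.
elim: t r r' X X' => [|s IH] r r' X X' /=.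
  move=> -> ->; apply/matrixP => i j.
  by rewrite !ord1 !mxE eqxx !mulr1n rmorphD !rmorphM.
move=> [hX [Y [cY eY]]] [hX' [Y' [cY' eY']]]; split.
  by apply: hermD; exact: hermZ.
exists (x%:C *: Y + x'%:C *: Y'); split; first exact: IH.
by rewrite ptr1D !ptr1Z eY eY' kronID !kronIZ.
Qed.

Lemma lcomb0 t : lcomb t 0 0.
Proof.
elim: t => [|s IH] /=; first by rewrite raddf0.
split; first exact: herm0.
exists 0; split=> //; rewrite kronI0.
by have := ptr1Z 0 (0 : 'M[C]_(NW s.+1 * (NV s.+1 * dim s))); rewrite rmorph0 !scale0r.
Qed.

(** Adjointness peels off one W factor and one V factor per level, until the scalar [r] remains at
    the root. *)
Lemma tester_lcomb t r phi X : tester t phi -> lcomb t r X -> hinner phi X = r.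
Proof.
elim: t r phi X => [|s IH] r phi X /=.
  by move=> -> ->; rewrite hinnerC hinner1 big_ord_recl big_ord0 addr0 mxE eqxx.
move=> [tau [_ -> tt]] [_ [Y [cY eY]]].
by rewrite hinner_kronI eY -hinner_ptr1; exact: IH cY.
Qed.

Definition wdim t : R := \prod_(u < t) (NW u.+1)%:R.
(** The comb that ignores its inputs and emits maximally mixed states. As a multiple of the identity
    it serves as an interior point. *)
Definition icomb t : 'M[C]_(dim t) := ((wdim t)^-1)%:C *: 1%:M.

Lemma wdim_gt0 t : (0 < dim t)%N -> 0 < wdim t.
Proof.
elim: t => [|s IH]; first by rewrite /wdim big_ord0.
move=> /dim_gt0[w _ /IH d]; rewrite /wdim big_ord_recr /= mulr_gt0 ?ltr0n//.
Qed.

Lemma icombS s : (0 < dim s.+1)%N -> icomb s.+1 =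
  ((NW s.+1)%:R^-1)%:C *: kronI (NW s.+1) (kronI (NV s.+1) (icomb s)).
Proof.
move=> d; rewrite /icomb !kronIZ !kronI1 scalerA -rmorphM.
by rewrite /wdim big_ord_recr /= invfM mulrC.
Qed.

Lemma trW_lift s (Z : 'M[C]_(NV s.+1 * dim s)) : (0 < NW s.+1)%N ->
  trW s (((NW s.+1)%:R^-1)%:C *: kronI (NW s.+1) Z) = Z.
Proof.
move=> w; rewrite ptr1Z ptr1_kronI scalerA -rmorphM mulVf ?rmorph1 ?scale1r//.
by rewrite pnatr_eq0 -lt0n.
Qed.

Lemma lcomb_shift t r X : (0 < dim t)%N -> lcomb t r X ->
  exists2 K, 0 <= K & forall k, K <= k -> pcomb t (r + k) (X + k%:C *: icomb t).
Proof.
elim: t r X => [|s IH] r X d /=.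
  move=> ->; exists 0 => // k _; rewrite /icomb /wdim big_ord0 invr1 rmorph1 scale1r.
  by apply/matrixP => i j; rewrite !ord1 !mxE eqxx !mulr1n mulr1 rmorphD.
have [w v ds] := dim_gt0 d.
move=> [hX [Y [/(IH _ _ ds)[K1 K10 hK1] eY]]].
have [K2 K20 hK2] := herm_shift hX.
have W0 := wdim_gt0 d.
(* [K1] serves the lower levels; the factor [wdim] undoes the normalisation of [icomb], so that the
   identity is added at least [K2] times. *)
exists (K1 + K2 * wdim s.+1); first by rewrite addr_ge0 // mulr_ge0 // ltW.
move=> k hk; split.
  rewrite /icomb scalerA -rmorphM; apply: hK2.
  rewrite ler_pdivlMr //; lra.
exists (Y + k%:C *: icomb s); split.
  by apply: hK1; have := mulr_ge0 K20 (ltW W0); lra.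
by rewrite ptr1D ptr1Z icombS // trW_lift // eY kronID kronIZ.
Qed.

Lemma lcomb_icomb t : (0 < dim t)%N -> lcomb t 1 (icomb t).
Proof.
elim: t => [|s IH] d /=.
  by rewrite /icomb /wdim big_ord0 invr1 rmorph1 scale1r.
have [w v ds] := dim_gt0 d; split; first by apply: hermZ; exact: herm1.
by exists (icomb s); split; [exact: IH|rewrite icombS // trW_lift].
Qed.
End Combs.


(** * Testers characterised through the comb constraints *)

Section TesterDuality.
Context {R : realType} (NV NW : nat -> nat).
Local Notation C := (R[i]).
Local Notation "x %:C" := (real_complex R x) : ring_scope.
Local Notation dim := (dimD NV NW).
Local Notation trW s := (@ptr1 R (NW s.+1) (NV s.+1 * dim s)).
Local Notation trV s := (@ptr1 R (NV s.+1) (dim s)).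
Local Notation lcomb := (@lcomb R NV NW).
Local Notation pcomb := (@pcomb R NV NW).
Local Notation tester := (@tester R NV NW).
Local Notation icomb := (@icomb R NV NW).
Local Notation wdim := (@wdim R NW).
Local Notation chn t := (@Defs.chn R NV NW t).
Local Notation SG t := (@Defs.SG R NV NW t).

Lemma pcombZ t r a X : 0 <= a -> pcomb t r X -> pcomb t (a * r) (a%:C *: X).
Proof.
move=> a0; elim: t r X => [|s IH] r X /=.
  move=> ->; apply/matrixP => i j.
  by rewrite !ord1 !mxE eqxx !mulr1n rmorphM.
move=> [pX [Y [cY eY]]]; split; first exact: psdZ.
by exists (a%:C *: Y); split; [exact: IH|rewrite ptr1Z eY kronIZ].
Qed.

Lemma pcomb_icomb t : (0 < dim t)%N -> pcomb t 1 (icomb t).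
Proof.
elim: t => [|s IH] d /=.
  by rewrite /icomb /wdim big_ord0 invr1 rmorph1 scale1r.
have [w v ds] := dim_gt0 d; split.
  by apply: psdZ; [rewrite invr_ge0 ltW // (wdim_gt0 d)|exact: psd1].
by exists (icomb s); split; [exact: IH|rewrite icombS // trW_lift].
Qed.

Lemma psd_icomb t : (0 < dim t)%N -> psd (icomb t).
Proof.
move=> d; apply: psdZ; last exact: psd1.
by rewrite invr_ge0 ltW // (wdim_gt0 d).
Qed.

Lemma pcomb_chain t X : pcomb t 1 X -> exists ct : forall u, 'M[C]_(dim u),
  [/\ ct t = X, ct 0 = 1%:M, (forall u, (0 < u <= t)%N -> psd (ct u)) &
      (forall u, (u < t)%N -> trW u (ct u.+1) = kronI (NV u.+1) (ct u))].
Proof.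
elim: t X => [|s IH] X /=.
  move=> ->; exists (fun u => 1%:M); split=> //.
  by case.
move=> [pX [Y [/IH[ct [ctE ct0 cpsd cchain]] eY]]].
(* The chain for the lower levels is overridden at the single index [s.+1]. *)
exists (@dfwith _ (fun u => 'M[C]_(dim u)) ct s.+1 X); split.
- by rewrite dfwith_in.
- by rewrite dfwith_out.
- move=> u /andP[u0]; rewrite leq_eqVlt => /orP[/eqP->|us]; first by rewrite dfwith_in.
  by rewrite dfwith_out ?gtn_eqF //; apply: cpsd; rewrite u0.
- move=> u; rewrite ltnS leq_eqVlt => /orP[/eqP->|us].
    by rewrite dfwith_in dfwith_out ?ctE // gtn_eqF.
  by rewrite !dfwith_out ?cchain // gtn_eqF // ltnS // ltnW.
Qed.

Lemma pcomb_chn t X : (0 < t)%N -> pcomb t 1 X -> chn t X.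
Proof.
move=> t0 pX; split; last exact: pcomb_chain.
by case: t t0 X pX => // s _ X [].
Qed.

(** A large multiple of the interior comb [icomb] makes [X] positive at all levels, so [X] is a
    combination of one rescaled comb and [icomb]. *)
Lemma lcomb_linspan t r X : (0 < t)%N -> (0 < dim t)%N -> lcomb t r X ->
  linspan (chn t) X.
Proof.
move=> t0 d /(lcomb_shift d)[K K0 hK].
(* Large enough both for positivity ([K <= k]) and for rescaling to root value 1 ([0 < r + k]). *)
pose k := K + `|r| + 1.
have rk : 0 < r + k by rewrite /k; have := ler_norm (- r); rewrite normrN; lra.
have kK : K <= k by rewrite /k; have := normr_ge0 r; lra.
have := pcombZ (ltW (_ : 0 < (r + k)^-1)) (hK k kK).
rewrite invr_gt0 => /(_ rk); rewrite mulVf ?gt_eqF // => p1.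
exists 2%N, (fun l => if l == 0 then r + k else - k).
exists (fun l => if l == 0 then ((r + k)^-1)%:C *: (X + k%:C *: icomb t) else icomb t).
split=> [l|].
  by case: ifP => _; apply: pcomb_chn => //; exact: pcomb_icomb.
rewrite big_ord_recl big_ord_recl big_ord0 addr0 /= scalerA -rmorphM.
by rewrite mulfV ?gt_eqF // rmorph1 scale1r rmorphN scaleNr addrK.
Qed.

Lemma chn_lcomb t X : chn t X -> lcomb t 1 X.
Proof.
case=> _ [ct [<- ct0 cpsd cchain]].
suff H u : (u <= t)%N -> lcomb u 1 (ct u) by exact: H.
elim: u => [_|u IH ut] /=; first by rewrite ct0 rmorph1.
split; first exact: (psd_herm (cpsd u.+1 ut)).
by exists (ct u); split; [exact/IH/ltnW|exact: cchain].
Qed.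

Lemma tr_ptr1 m n (X : 'M[C]_(m * n)) : \tr (ptr1 X) = \tr X.
Proof. by rewrite -[ptr1 X]mul1mx -mxtr_kronI kronI1 mul1mx. Qed.

Lemma mx11_eq1 (Y : 'M[C]_1) : \tr Y = 1 -> Y = 1%:M.
Proof.
rewrite /mxtrace big_ord_recl big_ord0 addr0 => h.
by apply/matrixP => i j; rewrite !ord1 h mxE.
Qed.

Lemma SG_tester t X : SG t.+1 X <-> tester t.+1 X.
Proof.
split=> [[tau [ptau tr1 chain ->]]|].
  suff H u : (u <= t)%N -> tester u.+1 (kronI (NW u.+1) (tau u)) by exact: H.
  elim: u => [_|u IH ut].
    exists (tau 0%N); split=> //; first exact: ptau.
    by apply: mx11_eq1; rewrite tr_ptr1.
  exists (tau u.+1); split=> //; first exact: ptau.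
  by rewrite (chain u ut); exact/IH/ltnW.
elim: t X => [|t IH] X [tau [ptau -> tt]].
  (* Only index 0 is constrained here, so the default 0 is never read. *)
  exists (@dfwith _ (fun u => 'M[C]_(NV u.+1 * dim u)) (fun=> 0) 0%N tau).
  split; rewrite ?dfwith_in //.
    by move=> [|u] // _; rewrite dfwith_in.
  by rewrite -tr_ptr1 tt mxtrace1.
have [f [pf f1 fchain fE]] := IH _ tt.
exists (@dfwith _ (fun u => 'M[C]_(NV u.+1 * dim u)) f t.+1 tau); split.
- move=> u; rewrite leq_eqVlt => /orP[/eqP->|us]; first by rewrite dfwith_in.
  by rewrite dfwith_out ?gtn_eqF //; exact: pf.
- by rewrite dfwith_out.
- move=> u; rewrite ltnS leq_eqVlt => /orP[/eqP->|us].
    by rewrite dfwith_in dfwith_out ?gtn_eqF // fE.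
  by rewrite !dfwith_out ?fchain // gtn_eqF // ltnS // ltnW.
- by rewrite dfwith_in.
Qed.

Lemma tester_psd t phi : tester t phi -> psd phi.
Proof.
case: t phi => [|s] phi /=; first by move=> ->; exact: psd1.
move=> [tau [ptau -> _]]; apply/psdP; split=> [|v].
  exact/herm_kronI/psd_herm.
by rewrite hinner_kronI; apply: psd_hinner_ge0 => //; exact/psd_ptr1/psd_rank1.
Qed.

(** A tester pairs to 1 with [icomb], the identity over [wdim t]. The inequality also covers the
    zero-dimensional space, where the trace is an empty sum. *)
Lemma tester_trace t phi : tester t phi -> hinner phi 1%:M <= wdim t.
Proof.
move=> tphi; have [d|] := posnP (dim t).
  rewrite hinner1 big1 => [|i _]; first by apply: prodr_ge0.
  by have := ltn_ord i; rewrite [X in (_ < X)%N]d.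
move=> d; have := tester_lcomb tphi (lcomb_icomb d).
have w0 : 0 < wdim t := wdim_gt0 d.
rewrite /icomb hinnerZr => h.
by rewrite -(mulVKf (lt0r_neq0 w0) (hinner phi _)) h mulr1.
Qed.

(** The existential lower-level operator is a continuous function of [X], its partial trace over
    both factors divided by the dimension of V, so it converges along with [X]. *)
Lemma lcomb_closed t r (U : set_system nat) (PU : ProperFilter U)
  (X : nat -> 'M[C]_(dim t)) L : (0 < dim t)%N ->
  mxcvg U X L -> (forall k, lcomb t r (X k)) -> lcomb t r L.
Proof.
elim: t X L => [|s IH] X L d XL hX.
  apply: (mxcvg_unique PU XL) => A.
  by under eq_fun do rewrite (hX _ : X _ = _); exact: cvg_cst.
have [w v ds] := dim_gt0 d.
split; first by apply: (mxcvg_herm PU XL) => k; case: (hX k).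
have /choice[Y hY] : forall k, exists Y, lcomb s r Y /\ trW s (X k) = kronI (NV s.+1) Y.
  by move=> k; case: (hX k).
have YE k : Y k = ((NV s.+1)%:R^-1)%:C *: trV s (trW s (X k)).
  have [_ ->] := hY k; rewrite ptr1_kronI scalerA -rmorphM mulVf ?rmorph1 ?scale1r//.
  by rewrite pnatr_eq0 -lt0n.
pose Z := ((NV s.+1)%:R^-1)%:C *: trV s (trW s L).
have YZ : mxcvg U Y Z.
  move=> A; under eq_fun do rewrite YE hinnerZl !hinner_ptr1.
  by rewrite /Z hinnerZl !hinner_ptr1; apply: cvgM; [exact: cvg_cst|exact: XL].
exists Z; split; first by apply: IH YZ _ => // k; case: (hY k).
apply: (@mxcvg_unique _ _ U PU (fun k => trW s (X k))) => A.
  by under eq_fun do rewrite hinner_ptr1; rewrite hinner_ptr1; exact: XL.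
under eq_fun do rewrite (proj2 (hY _)) hinner_kronI.
by rewrite hinner_kronI; exact: YZ.
Qed.

(** Converse of [tester_lcomb] for psd operators: orthogonality to [lcomb t 0] forces the tensor
    structure level by level. *)
Lemma tester_orth t Y : (0 < dim t)%N -> psd Y ->
  (forall X, lcomb t 0 X -> hinner Y X = 0) -> hinner Y (icomb t) = 1 -> tester t Y.
Proof.
elim: t Y => [|s IH] Y d pY orth nrm /=.
  apply: mx11_eq1; move: nrm.
  rewrite /icomb /wdim big_ord0 invr1 rmorph1 scale1r /hinner mulmx1.
  have := psd_herm pY; rewrite /mxtrace big_ord_recl big_ord0 addr0 => /hermP/(_ ord0 ord0).
  case: (Y ord0 ord0) => x y /= [] /eqP; rewrite -subr_eq0 opprK -mulr2n mulrn_eq0 /=.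
  by move=> /eqP -> ->.
have [w v ds] := dim_gt0 d.
(* The average of [Y] over W, the only candidate for [Y = kronI _ tau]. *)
pose tau := ((NW s.+1)%:R^-1)%:C *: trW s Y.
have ptau : psd tau.
  by apply: psdZ; [rewrite invr_ge0 ler0n|exact: psd_ptr1].
have hX : herm (Y - kronI (NW s.+1) tau).
  by apply: hermB; [exact: psd_herm|exact/herm_kronI/psd_herm].
have trX : trW s (Y - kronI (NW s.+1) tau) = 0.
  have E : ((NW s.+1)%:R)%:C *: tau = trW s Y.
    by rewrite /tau scalerA -rmorphM mulfV ?rmorph1 ?scale1r // pnatr_eq0 -lt0n.
  have -> : - kronI (NW s.+1) tau = (-1)%:C *: kronI (NW s.+1) tau.
    by rewrite rmorphN1 scaleN1r.
  by rewrite ptr1D ptr1Z ptr1_kronI E rmorphN1 scaleN1r subrr.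
(* The residual has zero partial trace, so it lies in [lcomb s.+1 0] and is orthogonal both to [Y]
   and to [kronI _ tau], hence to itself. *)
have YE : Y = kronI (NW s.+1) tau.
  apply/eqP; rewrite -subr_eq0; apply/eqP; apply: hinner_self_eq0 => //.
  rewrite hinnerBl hinner_kronI trX hinner0r subr0; apply: orth; split=> //.
  by exists 0; rewrite trX kronI0; split=> //; exact: lcomb0.
exists tau; split=> //; apply: IH => //; first exact: psd_ptr1.
  move=> Z cZ.
  (* Padding [Z] with identities turns the hypothesis on [Y] into the one on the partial trace of
     [tau]. *)
  have := orth (((NW s.+1)%:R^-1)%:C *: kronI (NW s.+1) (kronI (NV s.+1) Z)).
  rewrite {1}YE hinner_kronI trW_lift // -hinner_ptr1; apply; split.
    apply: hermZ; do 2!apply: herm_kronI.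
    by case: (s) Z cZ => [|u] Z /= => [->|[]//]; apply/hermP => i j;
      rewrite !mxE eq_sym; case: eqP => _ /=; rewrite ?mulr0n ?oppr0.
  by exists Z; rewrite trW_lift.
by move: nrm; rewrite {1}YE icombS // hinner_kronI trW_lift // hinner_ptr1.
Qed.
End TesterDuality.


(** * Duality *)

Section Duality.
Context {R : realType}.
Local Notation C := (R[i]).
Local Notation "x %:C" := (real_complex R x) : ring_scope.

(** Used to read off signs of multipliers, by going to infinity along a ray of the separated set. *)
Lemma affine_ge0 (g k : R) : (forall s, 0 <= s -> 0 <= k + s * g) -> 0 <= g.
Proof.
move=> h; rewrite leNgt; apply/negP => g0.
have s0 : 0 <= (`|k| + 1) / - g by rewrite divr_ge0 ?addr_ge0 // oppr_ge0 ltW.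
have := h _ s0; rewrite -[X in _ * X]opprK mulrN divfK ?oppr_eq0 ?lt_eqF//.
by have := ler_norm k; lra.
Qed.

Lemma cvg_nat_bounded (f : nat -> R) (l : R) : f n @[n --> \oo] --> l ->
  exists B, forall n, `|f n| <= B.
Proof.
move=> fl; have : bounded_fun f by apply: cvg_seq_bounded; apply/cvg_ex; exists l.
move=> [B [_ hB]]; exists (B + 1) => n.
by apply: (hB (B + 1)) => //; rewrite ltrDl.
Qed.

Lemma cvg_harmonic_rate (f : nat -> R) (l : R) :
  (forall n, `|f n - l| <= n.+1%:R^-1) -> f n @[n --> \oo] --> l.
Proof.
move=> h; apply/cvgrPdist_le => e e0.
have /cvgrPdist_le/(_ _ e0) := @cvg_harmonic R.
apply: filterS => n /=; rewrite sub0r normrN ger0_norm ?invr_ge0 // => le.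
by rewrite distrC (le_trans (h n)).
Qed.

Lemma mxcvg_rate n (X : nat -> 'M[C]_n) (L : 'M[C]_n) :
  (forall k i j, Normc.normc (X k i j - L i j) < k.+1%:R^-1) -> mxcvg \oo X L.
Proof.
move=> h; apply: mxcvg_entries => i j; apply: cvg_harmonic_rate => k;
  apply: le_trans (ltW (h k i j)).
- by apply: le_trans (Re_le_normc _); case: (X k i j) => x y; case: (L i j).
- by apply: le_trans (Im_le_normc _); case: (X k i j) => x y; case: (L i j).
Qed.

Lemma mxcvg_sub n (U V : set_system nat) (X : nat -> 'M[C]_n) L :
  V `<=` U -> mxcvg V X L -> mxcvg U X L.
Proof. by move=> VU XL A W /(XL A); exact: VU. Qed.

Lemma mxcvg_psd n (U : set_system nat) (PU : ProperFilter U)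
  (X : nat -> 'M[C]_n) L : mxcvg U X L -> (forall k, psd (X k)) -> psd L.
Proof.
move=> XL pX; apply/psdP; split=> [|v].
  by apply: (mxcvg_herm PU XL) => k; exact: psd_herm.
apply: ler_cvg_to (cvg_cst 0) (XL (rank1 v)) _.
by apply: nearW => k; exact: psd_rank1_ge0.
Qed.

Lemma mx_separation n (I : finType) (K : set ('M[C]_n * (I -> R))) X0 f0 :
  (forall k k' (t : R), K k -> K k' -> 0 <= t <= 1 ->
     K (t%:C *: k.1 + (1 - t)%:C *: k'.1, fun i => t * k.2 i + (1 - t) * k'.2 i)) ->
  (exists k : nat -> 'M[C]_n * (I -> R),
     [/\ forall p, K (k p), mxcvg \oo (fun p => (k p).1) X0 &
         forall i, (k p).2 i @[p --> \oo] --> (f0 i : R)]) \/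
  exists A q d, 0 < d /\ forall k, K k ->
    hinner k.1 A + \sum_i q i * k.2 i + d <= hinner X0 A + \sum_i q i * f0 i.
Proof.
move=> Kcvx.
pose co (k : 'M[C]_n * (I -> R)) (s : ('I_n * 'I_n + 'I_n * 'I_n) + I) : R :=
  match s with
  | inl (inl ij) => complex.Re (k.1 ij.1 ij.2)
  | inl (inr ij) => complex.Im (k.1 ij.1 ij.2)
  | inr i => k.2 i
  end.
have [|h|[y [d [d0 h]]]] := @separation R _ [set co k | k in K] (co (X0, f0)).
- move=> _ _ t [k Kk <-] [k' Kk' <-] t01.
  exists (t%:C *: k.1 + (1 - t)%:C *: k'.1, fun i => t * k.2 i + (1 - t) * k'.2 i).
    exact: Kcvx.
  apply/funext => -[[ij|ij]|i] //=; rewrite !mxE.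
    by case: (k.1 _ _) => a b; case: (k'.1 _ _) => a' b' /=; ring.
  by case: (k.1 _ _) => a b; case: (k'.1 _ _) => a' b' /=; ring.
- left.
  have /choice[k hk] : forall p : nat, exists k, K k /\
      (* Squaring the rate makes every single coordinate converge at rate 1/(p+1). *)
      \sum_s (co k s - co (X0, f0) s) ^+ 2 < p.+1%:R^-1 ^+ 2.
    move=> p; have [|_ [k Kk <-] lt] := h (p.+1%:R^-1 ^+ 2).
      by rewrite exprn_gt0 // invr_gt0.
    by exists k.
  have H s : co (k p) s @[p --> \oo] --> co (X0, f0) s.
    apply: cvg_harmonic_rate => p; rewrite -ler_sqr ?nnegrE ?invr_ge0//.
    rewrite real_normK ?num_real//; apply: le_trans (ltW (proj2 (hk p))).
    by rewrite (bigD1 s) //= lerDl sumr_ge0 // => j _; exact: sqr_ge0.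
  exists k; split=> [p||i].
  + by case: (hk p).
  + by apply: mxcvg_entries => i j;
      [exact: (H (inl (inl (i, j))))|exact: (H (inl (inr (i, j))))].
  + exact: (H (inr i)).
(* The transpose and the minus sign match [hinnerE], where [X i j] meets [A j i] and imaginary parts
   enter negatively. *)
- right; pose A := \matrix_(j, i) Complex (y (inl (inl (i, j)))) (- y (inl (inr (i, j)))).
  have E k : \sum_s y s * co k s = hinner k.1 A + \sum_i y (inr i) * k.2 i.
    rewrite hinnerE big_sumType /= big_sumType /=; congr (_ + _).
    rewrite -big_split pair_big /=; apply: eq_bigr => -[i j] _ /=.
    by rewrite !mxE /=; ring.
  exists A, (fun i => y (inr i)), d; split=> // k Kk.
  by have := h _ (ex_intro2 _ _ k Kk erefl); rewrite !E.
Qed.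

Section Tester.
Variables NV NW : nat -> nat.
Local Notation dim := (dimD NV NW).

Lemma lcomb_herm t r (X : 'M[C]_(dim t)) : lcomb NV NW t r X -> herm X.
Proof.
case: t X => [|s] X /= => [->|[]//]; apply/hermP => i j.
by rewrite !mxE eq_sym; case: eqP => _ /=; rewrite ?mulr0n ?mulr1n /= oppr0.
Qed.

Lemma lcomb_trace t r (X : 'M[C]_(dim t)) : lcomb NV NW t r X ->
  hinner X 1%:M = r * \prod_(u < t) (NV u.+1)%:R.
Proof.
elim: t r X => [|s IH] r X /=.
  by move=> ->; rewrite hinner1 big_ord_recl !big_ord0 addr0 mulr1 mxE eqxx.
move=> [_ [Y [/IH hY eY]]].
rewrite -(kronI1 (NW s.+1)) -hinner_ptr1 eY hinner_kronI -(kronI1 (NV s.+1)).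
by rewrite ptr1_kronI hinnerZr hY big_ord_recr /=; ring.
Qed.

Lemma tester_duality t (chi : 'M[C]_(dim t)) (lam : R) : (0 < dim t)%N -> herm chi ->
  (forall phi, tester NV NW t phi -> hinner phi chi <= lam) ->
  exists chi', lcomb NV NW t lam chi' /\ psd (chi' - chi).
Proof.
move=> d hchi hlam.
(* All operators dominated by some element of [lcomb t lam]; the index type [void] says that there
   are no scalar coordinates. *)
pose K := [set k : 'M[C]_(dim t) * (void -> R) |
   exists2 X, lcomb NV NW t lam X & psd (X - k.1)].
have [|[k [Kk kchi _]]|[A [q [e [e0 hsep]]]]] := @mx_separation _ _ K chi (fun=> 0).
- move=> k k' s [X cX pX] [X' cX' pX'] /andP[s0 s1].
  exists (s%:C *: X + (1 - s)%:C *: X').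
    by have := lcomb_comb s (1 - s) cX cX'; rewrite -mulrDl addrC subrK mul1r.
  rewrite /= opprD addrACA -!scalerBr; apply: psdD; apply: psdZ => //.
  by rewrite subr_ge0.
- have /choice[X hX] : forall p, exists X, lcomb NV NW t lam X /\ psd (X - (k p).1).
    by move=> p; have [X cX pX] := Kk p; exists X.
  have [B hB] := cvg_nat_bounded (kchi 1%:M).
  have [U [UU sU]] := ultra_nat.
  have PU : ProperFilter U by exact: ultra_proper.
  (* The trace of [X p] is fixed by [lcomb_trace], so the psd differences have bounded trace and
     converge along [U]. *)
  have [P hP] : exists P, mxcvg U (fun p => X p - (k p).1) P.
    apply: (@mxcvg_bounded _ _ _ UU _ (lam * \prod_(u < t) (NV u.+1)%:R + B)) => p i j.
    have [cX pX] := hX p; have [h1 h2] := psd_bounded i j pX.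
    have le : hinner (X p - (k p).1) 1%:M <= lam * \prod_(u < t) (NV u.+1)%:R + B.
      rewrite hinnerBl (lcomb_trace cX) lerD2l.
      by apply: le_trans (hB p); rewrite -normrN ler_norm.
    by split; apply: le_trans le.
  exists (chi + P); split; last first.
    by rewrite addrC addKr; apply: (mxcvg_psd PU hP) => p; case: (hX p).
  apply: (@lcomb_closed _ _ _ _ _ U PU X) => // [A|p]; last by case: (hX p).
  rewrite hinnerDl; under eq_fun => p.
    rewrite (_ : X p = (k p).1 + (X p - (k p).1)); last by rewrite addrC subrK.
    rewrite hinnerDl; over.
  by apply: cvgD; [exact: (mxcvg_sub sU kchi)|exact: hP].
- exfalso.
  pose Y := hpart A.
  have hsep' Z p : lcomb NV NW t lam Z -> psd p -> hinner Y Z - hinner Y p + e <= hinner Y chi.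
    move=> cZ pp; have := hsep (Z - p, fun=> 0) _.
    rewrite /= !big1 ?addr0 => [h|[]//].
    have hp := psd_herm pp; have hZ := lcomb_herm cZ.
    by rewrite !(hinnerC Y) !hinner_hpart // -hinnerBl; apply: h; exists Z; rewrite //= opprB addrC subrK.
  have c1 : lcomb NV NW t (1 : R) (icomb NV NW t) := lcomb_icomb d.
  have c0 : lcomb NV NW t lam (lam%:C *: icomb NV NW t).
    by have := lcomb_comb lam 0 c1 c1; rewrite rmorph0 scale0r mul0r mulr1 !addr0.
  (* [K] is closed under subtracting psd operators; going to infinity along [- rank1 v] shows that
     the form of [Y] is nonnegative. *)
  have pY : psd Y.
    apply/psdP; split=> [|v]; first exact: herm_hpart.
    apply: (@affine_ge0 _ (hinner Y chi - e - hinner Y (lam%:C *: icomb NV NW t))) => s s0.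
    have := hsep' _ _ c0 (psdZ s0 (psd_rank1 v)); rewrite (hinnerZr s).
    move: (hinner Y chi) (hinner Y _) (hinner Y _) => x y z; clear; lra.
  (* A linear functional bounded above on a whole line is zero on its direction. *)
  have orth X : lcomb NV NW t 0 X -> hinner Y X = 0.
    move=> cX.
    have H x : x * hinner Y X + lam * hinner Y (icomb NV NW t) + e <= hinner Y chi.
      have := lcomb_comb x lam cX c1; rewrite mulr0 add0r mulr1 => cx.
      by have := hsep' _ _ cx (psd0 _); rewrite hinner0r subr0 hinnerDr !hinnerZr.
    apply/eqP; rewrite eq_le -[_ <= 0]oppr_ge0; apply/andP; split;
      apply: (@affine_ge0 _ (hinner Y chi - e - lam * hinner Y (icomb NV NW t))) => s s0.
      by have := H s; lra.
    by have := H (- s); lra.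
  have key : lam * hinner Y (icomb NV NW t) + e <= hinner Y chi.
    by have := hsep' _ _ c0 (psd0 _); rewrite hinner0r subr0 hinnerZr.
  have pI : psd (icomb NV NW t : 'M[C]_(dim t)) := psd_icomb d.
  (* If [Y] pairs to 0 with [icomb], its trace vanishes and so does [Y], against the gap [e];
     otherwise [Y] rescales to a tester that violates [hlam]. *)
  have := psd_hinner_ge0 pY pI; rewrite le_eqVlt => /orP[/eqP k0|k0].
    suff Y0 : Y = 0 by move: key; rewrite Y0 !hinner0l; lra.
    have tr0 : hinner Y 1%:M = 0.
      move: k0; rewrite /icomb hinnerZr => /esym/eqP.
      rewrite mulf_eq0 invr_eq0 gt_eqF ?(@wdim_gt0 R _ _ _ d)//= => /eqP->//.
    apply/matrixP => i j; have := psd_bounded i j pY; rewrite tr0 !normr_le0 [RHS]mxE.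
    by case: (Y i j) => x y /= [/eqP-> /eqP->].
  set kap := hinner Y (icomb NV NW t) in k0 key.
  have : tester NV NW t ((kap^-1)%:C *: Y).
    apply: (tester_orth d).
    - by apply: psdZ => //; rewrite invr_ge0 ltW.
    - by move=> X /orth h; rewrite hinnerZl h mulr0.
    - by rewrite hinnerZl mulVf // gt_eqF.
  move=> /hlam; rewrite hinnerZl mulrC ler_pdivrMr //; lra.
Qed.
End Tester.
End Duality.


(** * Weak and strong duality *)

Section ConicDuality.
Context {R : realType} {NV NW : nat -> nat} {T M J : nat}.
Local Notation C := (R[i]).
Local Notation "x %:C" := (real_complex R x) : ring_scope.
Local Notation N := (dimD NV NW T).
Local Notation tuple := ('I_M -> 'M[C]_N).
Variables (c : 'I_M -> 'M[C]_N) (a : 'I_J -> 'I_M -> 'M[C]_N) (b : 'I_J -> R).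
Hypotheses (hc : forall m, herm (c m)) (ha : forall j m, herm (a j m)).
Local Notation P := (Pobj c).
Local Notation eta := (eta_j a b).

Lemma sum_hinner_zq (q : 'I_J -> R) chi (Phi : tuple) :
  \sum_m hinner (Phi m) (chi - zq c a q m) =
  hinner (\sum_m Phi m) chi - P Phi + \sum_j q j * (eta j Phi + b j).
Proof.
rewrite hinner_suml /Pobj.
under [X in _ = _ + X]eq_bigr do rewrite /eta_j subrK mulr_sumr.
rewrite exchange_big /= -sumrB -big_split /=; apply: eq_bigr => m _.
rewrite hinnerBr /zq hinnerBr hinner_sumr opprB.
rewrite addrCA addrC; congr (_ + _).
by apply: eq_bigr => j _; rewrite hinnerZr.
Qed.

Lemma normc_distC (x y : C) : Normc.normc (x - y) = Normc.normc (y - x).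
Proof.
case: x y => [x1 x2] [y1 y2] /=.
by rewrite -[(x1 - y1) ^+ 2]sqrrN -[(x2 - y2) ^+ 2]sqrrN !opprB.
Qed.

Lemma big_option (V : nmodType) (I : finType) (F : option I -> V) :
  \sum_o F o = F None + \sum_i F (Some i).
Proof.
rewrite (bigD1 None) //=; congr (_ + _).
rewrite (reindex_omap Some id) => [|[]//] /=.
by apply: eq_bigl => i; rewrite eqxx.
Qed.

Lemma herm_zq (q : 'I_J -> R) m : herm (zq c a q m).
Proof.
apply: hermB => //; apply: herm_sum => j; exact: hermZ.
Qed.

Lemma sub_clos (A : set tuple) : A `<=` clos A.
Proof.
move=> Phi APhi e e0; exists Phi; split=> // m i j.
by rewrite subrr Normc.normc0.
Qed.

Lemma clos_seq (A : set tuple) Phi : clos A Phi ->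
  exists Psi : nat -> tuple, (forall k, A (Psi k)) /\
    forall m, mxcvg \oo (fun k => Psi k m) (Phi m).
Proof.
move=> cl; have /choice[Psi hPsi] : forall k : nat, exists Psi, A Psi /\
    forall m i j, Normc.normc (Phi m i j - Psi m i j) < k.+1%:R^-1.
  by move=> k; apply: cl; rewrite invr_gt0.
exists Psi; split=> [k|m]; first by case: (hPsi k).
apply: mxcvg_rate => k i j; have [_ /(_ m i j)] := hPsi k.
by rewrite normc_distC.
Qed.

Lemma weak_duality (Tt Cc : set tuple) (S : set 'M[C]_N) p :
  Tt `<=` [set Phi | Cc Phi /\ S (\sum_m Phi m)] ->
  Dfeas c a Cc p -> (Pval c a b Tt <= Dobj b S p)%E.
Proof.
move=> sT [hchi q0 [_ hdual]]; apply: ge_ereal_sup => _ [Phi [/sT[CPhi SPhi] hPhi] <-].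
have := hdual _ CPhi; rewrite sum_hinner_zq => h.
apply: (@le_trans _ _ ((hinner (\sum_m Phi m) p.1)%:E + (\sum_j p.2 j * b j)%:E)%E).
  rewrite -EFinD lee_fin.
  have : \sum_j p.2 j * (eta j Phi + b j) <= \sum_j p.2 j * b j.
    apply: ler_sum => j _; apply: ler_wpM2l => //; by have := hPhi j; lra.
  lra.
rewrite leeD2r //; apply: ereal_sup_ubound; by exists (\sum_m Phi m).
Qed.

Section Strong.
Variables (Tt Cc : set tuple) (S : set 'M[C]_N) (B : R).
Hypotheses (Cclosed : closed_tu Cc) (Ccvx : convex_tu Cc) (Ccone : cone_tu Cc).
Hypotheses (Sclosed : closed_mx S) (Scvx : convex_mx S).
Hypothesis Tclos : clos Tt = [set Phi | Cc Phi /\ S (\sum_m Phi m)].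
Hypothesis CG : Cc `<=` @CG R NV NW T M.
Hypotheses (Spsd : forall phi, S phi -> psd phi)
  (Sbounded : forall phi, S phi -> hinner phi 1%:M <= B).
Hypothesis Pclos :
  clos (Pfeas a b Tt) = [set Phi | clos Tt Phi /\ forall j, eta j Phi <= 0].
Hypothesis Pne : Pfeas a b Tt !=set0.

Let sT : Tt `<=` [set Phi | Cc Phi /\ S (\sum_m Phi m)].
Proof. by rewrite -Tclos; exact: sub_clos. Qed.

(** [Phi] and [phi] vary independently, the first coordinate recording their mismatch. The
    inequalities let constraint values rise and the objective fall freely, which fixes the signs of
    the multipliers. *)
Let values : set ('M[C]_N * (option 'I_J -> R)) := [set k |
  exists Phi phi, [/\ Cc Phi, S phi, k.1 = \sum_m Phi m - phi,
    forall j, eta j Phi <= k.2 (Some j) & k.2 None <= P Phi]].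

Lemma mxcvg_Pobj (U : set_system nat) (FU : Filter U) (Phi : nat -> tuple) L (d : tuple) :
  (forall m, mxcvg U (fun k => Phi k m) (L m)) ->
  \sum_m hinner (Phi k m) (d m) @[k --> U] --> (\sum_m hinner (L m) (d m) : R).
Proof. by move=> h; apply: cvg_fsum => m; exact: h. Qed.

Lemma values_closed (v : R) (k : nat -> 'M[C]_N * (option 'I_J -> R)) :
  (forall p, values (k p)) -> mxcvg \oo (fun p => (k p).1) 0 ->
  (forall j, (k p).2 (Some j) @[p --> \oo] --> (0 : R)) ->
  (k p).2 None @[p --> \oo] --> v ->
  exists Phi, [/\ clos Tt Phi, forall j, eta j Phi <= 0 & v <= P Phi].
Proof.
move=> hk k0 kj kv.
have /choice[Phi hPhi] := hk; have {hPhi}/choice[phi hphi] := hPhi.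
have [B' hB'] := cvg_nat_bounded (k0 1%:M).
have [U [UU sU]] := ultra_nat.
have PU : ProperFilter U by exact: ultra_proper.
have FU : Filter U by exact: _.
have /choice[L hL] : forall m, exists L, mxcvg U (fun p => Phi p m) L.
  (* The trace of [Phi p m] is at most that of the sum, which is the trace of [phi p] (at most [B])
     plus that of the mismatch (at most [B']). *)
  move=> m; apply: (@mxcvg_bounded _ _ _ UU _ (B' + B)) => p i j.
  have [/CG pPhi Sp E _ _] := hphi p.
  have [h1 h2] := psd_bounded i j (pPhi m).
  have le : hinner (Phi p m) 1%:M <= B' + B.
    apply: (@le_trans _ _ (hinner (\sum_m Phi p m) 1%:M)).
      rewrite hinner_suml (bigD1 m) //= lerDl sumr_ge0 // => l _.
      by apply: psd_hinner_ge0; [exact: pPhi|exact: psd1].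
    have -> : \sum_m Phi p m = (k p).1 + phi p by rewrite E subrK.
    rewrite hinnerDl lerD ?Sbounded //.
    by apply: le_trans (hB' p); exact: ler_norm.
  by split; apply: le_trans le.
have sumL : mxcvg U (fun p => \sum_m Phi p m) (\sum_m L m).
  move=> A; rewrite hinner_suml; under eq_fun do rewrite hinner_suml.
  by apply: cvg_fsum => m; exact: hL.
have phiL : mxcvg U phi (\sum_m L m).
  move=> A; rewrite -[hinner _ A]subr0 -(hinner0l A); under eq_fun => p.
    rewrite (_ : phi p = \sum_m Phi p m - (k p).1); last first.
      by have [_ _ -> _ _] := hphi p; rewrite opprB addrC subrK.
    rewrite hinnerBl; over.
  by apply: cvgB; [exact: sumL|exact: (mxcvg_sub sU k0)].
exists L; split.
- rewrite Tclos; split.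
    apply: Cclosed => e e0.
    have H m := mxcvg_near FU (hL m) e0.
    have [p hp] := filter_ex (@filter_forall _ _ _ _ _ H).
    exists (Phi p); split; first by case: (hphi p).
    by move=> m i j; rewrite normc_distC; exact: hp.
  apply: Sclosed => e e0.
  have [p hp] := filter_ex (mxcvg_near FU phiL e0).
  exists (phi p); split; first by case: (hphi p).
  by move=> i j; rewrite normc_distC; exact: hp.
- move=> j; apply: ler_cvg_to (_ : eta j (Phi p) @[p --> U] --> _) (_ : _ @[p --> U] --> _) _.
  + by apply: cvgB; [exact: mxcvg_Pobj|exact: cvg_cst].
  + by move=> V /(kj j); exact: sU.
  + by apply: nearW => p; case: (hphi p).
- apply: ler_cvg_to (_ : (k p).2 None @[p --> U] --> _) (_ : P (Phi p) @[p --> U] --> _) _.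
  + by move=> V /kv; exact: sU.
  + exact: mxcvg_Pobj.
  + by apply: nearW => p; case: (hphi p).
Qed.

Lemma values_cvx k k' (t : R) : values k -> values k' -> 0 <= t <= 1 ->
  values (t%:C *: k.1 + (1 - t)%:C *: k'.1, fun i => t * k.2 i + (1 - t) * k'.2 i).
Proof.
move=> [Phi [phi [CPhi Sphi E1 Ej E0]]] [Phi' [phi' [CPhi' Sphi' E1' Ej' E0']]] t01.
have /andP[t0 t1] := t01; have t1' : 0 <= 1 - t by rewrite subr_ge0.
have lin (d : tuple) : \sum_m hinner (t%:C *: Phi m + (1 - t)%:C *: Phi' m) (d m)
   = t * \sum_m hinner (Phi m) (d m) + (1 - t) * \sum_m hinner (Phi' m) (d m).
  by rewrite !mulr_sumr -big_split; apply: eq_bigr => m _; rewrite hinnerDl !hinnerZl.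
exists (fun m => t%:C *: Phi m + (1 - t)%:C *: Phi' m).
exists (t%:C *: phi + (1 - t)%:C *: phi'); split => /=.
- exact: Ccvx.
- exact: Scvx.
- by rewrite E1 E1' big_split -!scaler_sumr /= !scalerBr opprD addrACA.
- move=> j; rewrite /eta_j lin.
  have := ler_wpM2l t0 (Ej j); have := ler_wpM2l t1' (Ej' j); rewrite /eta_j; lra.
- rewrite /Pobj lin.
  have := ler_wpM2l t0 E0; have := ler_wpM2l t1' E0'; rewrite /Pobj; lra.
Qed.

Lemma strong_duality : Pval c a b Tt = Dval c a b Cc S.
Proof.
apply/eqP; rewrite eq_le; apply/andP; split.
  by apply: le_ereal_inf_tmp => _ [p hp <-]; exact: weak_duality sT hp.
have [Phi0 F0] := Pne.
have [[T0 eta0] [C0 S0]] := (F0, sT (proj1 F0)).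
have v0 : ((P Phi0)%:E <= Pval c a b Tt)%E.
  by apply: ereal_sup_ubound; exists Phi0.
case Ev : (Pval c a b Tt) => [v| |]; last by move: v0; rewrite Ev.
  2: exact: leey.
have vub Phi : Pfeas a b Tt Phi -> P Phi <= v.
  by move=> F; rewrite -lee_fin -Ev; apply: ereal_sup_ubound; exists Phi.
(* The value [v] itself may be a limit of [values]; raised by [e] it is not. *)
apply/lee_addgt0Pr => e e0; rewrite -EFinD.
have [|[k [hk k1 k2]]|[A [q [d [d0 hsep]]]]] :=
  @mx_separation _ _ _ values 0 (fun o => if o is Some _ then 0 else v + e).
- exact: values_cvx.
- exfalso.
  have [Phi [cT heta hP]] := values_closed hk k1 (fun j => k2 (Some j)) (k2 None).
  have : clos (Pfeas a b Tt) Phi by rewrite Pclos.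
  move=> /clos_seq[Psi [FPsi cPsi]].
  have : P Phi <= v.
    apply: ler_cvg_to (mxcvg_Pobj _ cPsi) (cvg_cst v) _.
    by apply: nearW => p; exact: vub.
  lra.
have rhs : \sum_i q i * (if i is Some _ then 0 else v + e) = q None * (v + e).
  rewrite (bigD1 None) //= big1 ?addr0 // => -[j|] // _.
  by rewrite mulr0.
have lhs (f : option 'I_J -> R) : \sum_i q i * f i
    = q None * f None + \sum_j q (Some j) * f (Some j).
  by rewrite big_option.
pose r := q None; pose w j := q (Some j).
have hs Phi phi f0 f : Cc Phi -> S phi -> (forall j, eta j Phi <= f j) -> f0 <= P Phi ->
    hinner (\sum_m Phi m) A - hinner phi A + (r * f0 + \sum_j w j * f j) + d
      <= r * (v + e).
  move=> CP Sp hj h0; pose F o := if o is Some j then f j else f0.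
  have := hsep (\sum_m Phi m - phi, F); rewrite rhs lhs hinner0l add0r /= hinnerBl.
  by apply; exists Phi, phi.
have hs0 f0 f : (forall j, 0 <= f j) -> f0 <= P Phi0 ->
    r * f0 + \sum_j w j * f j + d <= r * (v + e).
  move=> hj h0; have := hs Phi0 _ f0 f C0 S0 (fun j => le_trans (eta0 j) (hj j)) h0.
  by rewrite subrr add0r.
have w0 j : w j <= 0.
  rewrite -oppr_ge0; apply: (@affine_ge0 R _ (r * (v + e) - d - r * P Phi0)) => s s0.
  have := hs0 (P Phi0) (fun i => (i == j)%:R * s) _ (lexx _).
  rewrite (bigD1 j) //= big1 => [|i /negPf ij]; last by rewrite ij mul0r mulr0.
  rewrite eqxx mul1r addr0 => h; have {h} := h (fun i => mulr_ge0 (ler0n _ _) s0).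
  lra.
have sum0 : \sum_(j < J) w j * 0 = 0 by rewrite big1 // => j _; rewrite mulr0.
have r0 : 0 <= r.
  apply: (@affine_ge0 R _ (r * (v + e) - d - r * P Phi0)) => s s0.
  have := hs0 (P Phi0 - s) (fun=> 0) (fun=> lexx _).
  rewrite sum0 lerBlDr lerDl => /(_ s0); rewrite mulrBr; lra.
(* At the feasible [Phi0] with no mismatch and zero constraint values, [r = 0] would give
   [d <= 0]. *)
have {}r0 : 0 < r.
  rewrite lt_neqAle r0 andbT; apply/eqP => r00.
  have := hs0 (P Phi0) (fun=> 0) (fun=> lexx _) (lexx _).
  rewrite sum0 -r00 !mul0r; move: d0; lra.
pose chi := (- r^-1)%:C *: hpart A.
pose p j := - r^-1 * w j.
have hchi phi : herm phi -> r * hinner phi chi = - hinner phi A.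
  by move=> hphi; rewrite hinnerZr hinner_hpart // mulrA mulrN mulfV ?gt_eqF// mulN1r.
have hp j : r * p j = - w j by rewrite mulrA mulrN mulfV ?gt_eqF// mulN1r.
have hermS Phi : Cc Phi -> herm (\sum_m Phi m).
  by move=> /CG h; apply: herm_sum => m; apply: psd_herm; exact: h.
have feas : Dfeas c a Cc (chi, p).
  split=> /= [|j|]; first by apply: hermZ; exact: herm_hpart.
    by rewrite mulr_le0 // oppr_le0 invr_ge0 ltW.
  split=> [m|Phi CP].
    by apply: hermB; [apply: hermZ; exact: herm_hpart|exact: herm_zq].
  rewrite sum_hinner_zq -(pmulr_rge0 _ r0) [r * _]mulrDr [r * (_ - _)]mulrBr.
  rewrite (hchi _ (hermS _ CP)).
  have -> : r * (\sum_j p j * (eta j Phi + b j)) = - \sum_j w j * (eta j Phi + b j).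
    by rewrite mulr_sumr -sumrN; apply: eq_bigr => j _; rewrite mulrA hp mulNr.
  (* The exact constraint values at [s] times [Phi]. Then [hs] is affine in [s], and its slope is
     the dual cone inequality. *)
  pose f s j := s * \sum_m hinner (Phi m) (a j m) - b j.
  apply: (@affine_ge0 R _ (r * (v + e) - d + hinner (\sum_m Phi0 m) A
                         + \sum_j w j * b j)) => s s0.
  have lin (x : tuple) : \sum_m hinner (s%:C *: Phi m) (x m) = s * \sum_m hinner (Phi m) (x m).
    by rewrite mulr_sumr; apply: eq_bigr => m _; rewrite hinnerZl.
  have e1 j : eta j (fun m => s%:C *: Phi m) <= f s j by rewrite /eta_j lin.
  have e2 : s * P Phi <= P (fun m => s%:C *: Phi m) by rewrite /Pobj lin.
  have := hs _ _ _ _ (Ccone CP s0) S0 e1 e2; rewrite -scaler_sumr hinnerZl.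
  have -> : \sum_j w j * f s j
      = s * (\sum_j w j * (eta j Phi + b j)) - \sum_j w j * b j.
    rewrite mulr_sumr -sumrB; apply: eq_bigr => j _.
    by rewrite /f /eta_j subrK; ring.
  move: (hinner (\sum_m Phi m) A) (hinner (\sum_m Phi0 m) A) (P Phi)
    (\sum_j w j * b j) (\sum_j w j * (eta j Phi + b j)) => x y z t u; nra.
apply: (@le_trans _ _ (Dobj b S (chi, p))).
  by apply: ereal_inf_lbound; exists (chi, p).
rewrite /Dobj /= -leeBrDr //; apply: ge_ereal_sup => _ [phi Sphi <-].
rewrite -EFinB lee_fin.
(* The zero tuple removes [Phi] from [hs], leaving a bound on the pairing of [chi] with each [phi]
   in [S], that is on [lambdaS]. *)
have C00 := Ccone C0 (lexx 0).
have z0 (x : tuple) : \sum_m hinner (0%:C *: Phi0 m) (x m) = 0.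
  by apply: big1 => m _; rewrite hinnerZl mul0r.
have e1 j : eta j (fun m => 0%:C *: Phi0 m) <= - b j by rewrite /eta_j z0 sub0r.
have e2 : 0 <= P (fun m => 0%:C *: Phi0 m) by rewrite /Pobj z0.
have := hs _ _ _ _ C00 Sphi e1 e2; rewrite -scaler_sumr hinnerZl mul0r mulr0 !add0r.
have -> : \sum_j w j * - b j = - \sum_j w j * b j.
  by rewrite -sumrN; apply: eq_bigr => j _; rewrite mulrN.
move=> h; rewrite -(ler_pM2l r0) mulrBr (hchi _ (psd_herm (Spsd Sphi))).
have -> : r * (\sum_j p j * b j) = - \sum_j w j * b j.
  by rewrite mulr_sumr -sumrN; apply: eq_bigr => j _; rewrite mulrA hp mulNr.
move: h d0; move: (hinner phi A) (\sum_j w j * b j) => x y; lra.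
Qed.
End Strong.
End ConicDuality.


(** * Support functions and comparison of the two problems *)

Section Comparison.
Context {R : realType} {NV NW : nat -> nat}.
Local Notation C := (R[i]).
Local Notation "x %:C" := (real_complex R x) : ring_scope.

Lemma SG_tester_gt0 T (phi : 'M[C]_(dimD NV NW T)) : (0 < T)%N ->
  @SG R NV NW T phi <-> tester NV NW T phi.
Proof. by case: T phi => // T phi _; exact: SG_tester. Qed.

Lemma linspan_chn_const T chi : (0 < T)%N -> linspan (@chn R NV NW T) chi ->
  exists k : R, forall phi, @SG R NV NW T phi -> hinner phi chi = k.
Proof.
move=> T0 [k [r [Y [hY ->]]]]; exists (\sum_l r l) => phi /(SG_tester_gt0 _ T0) tphi.
rewrite hinner_sumr; apply: eq_bigr => l _.
by rewrite hinnerZr (tester_lcomb tphi (chn_lcomb (hY l))) mulr1.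
Qed.

Lemma lambdaS_const T (S : set 'M[C]_(dimD NV NW T)) chi (k : R) : S !=set0 ->
  (forall phi, S phi -> hinner phi chi = k) -> lambdaS S chi = k%:E.
Proof.
move=> [phi0 S0] h; rewrite /lambdaS (_ : [set _ | _ in S] = [set k%:E]) ?ereal_sup1//.
by apply/seteqP; split=> [_ [phi Sphi <-]|_ ->] /=; [rewrite h|exists phi0; rewrite ?h].
Qed.

(** [chi] is below [K] times the identity, and testers have trace at most [wdim]; a member of S_G
    gives the lower bound. *)
Lemma lambdaS_SG_fin T (chi : 'M[C]_(dimD NV NW T)) : (0 < T)%N -> herm chi ->
  @SG R NV NW T !=set0 -> lambdaS (@SG R NV NW T) chi \is a fin_num.
Proof.
move=> T0 hchi [phi0 S0]; rewrite fin_numElt; apply/andP; split.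
  by apply: (@lt_le_trans _ _ (hinner phi0 chi)%:E);
    [exact: ltNyr|apply: ereal_sup_ubound; exists phi0].
have [K K0 /(_ K (lexx K)) pK] := herm_shift (hermN hchi).
apply: (@le_lt_trans _ _ (K * wdim NW T)%:E); last exact: ltry.
apply: ge_ereal_sup => _ [phi /(SG_tester_gt0 _ T0) tphi <-]; rewrite lee_fin.
have := psd_hinner_ge0 (tester_psd tphi) pK.
rewrite hinnerDr hinnerNr hinnerZr.
have := ler_wpM2l K0 (tester_trace tphi).
by move: (hinner phi 1%:M) (hinner phi chi) => x y; lra.
Qed.

Lemma lambdaS_le T (S S' : set 'M[C]_(dimD NV NW T)) chi : S `<=` S' ->
  (lambdaS S chi <= lambdaS S' chi)%E.
Proof. by move=> SS'; apply: ereal_sup_le => _ [phi /SS' S'phi <-]; exists phi. Qed.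
End Comparison.

Unset Implicit Arguments.

Theorem theorem3 (R : realType) (NV NW : nat -> nat) (T : nat) (hT : (1 <= T)%N)
  (M : nat) (hM : (2 <= M)%N) (J : nat)
  (c : 'I_M -> 'M[R[i]]_(dimD NV NW T))
  (a : 'I_J -> 'I_M -> 'M[R[i]]_(dimD NV NW T)) (b : 'I_J -> R)
  (hc : forall m, herm (c m)) (ha : forall j m, herm (a j m))
  (T1 T2 : set ('I_M -> 'M[R[i]]_(dimD NV NW T)))
  (C1 C2 : set ('I_M -> 'M[R[i]]_(dimD NV NW T)))
  (S1 S2 : set 'M[R[i]]_(dimD NV NW T))
  (hT1ne : T1 !=set0) (hT2ne : T2 !=set0)
  (hT1cvx : convex_tu T1) (hT2cvx : convex_tu T2)
  (hT12 : T1 `<=` T2) (hT2G : T2 `<=` @TG R NV NW T M)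
  (hC1 : closed_tu C1 /\ convex_tu C1 /\ cone_tu C1)
  (hC2 : closed_tu C2 /\ convex_tu C2 /\ cone_tu C2)
  (hS1 : closed_mx S1 /\ convex_mx S1)
  (hS2 : closed_mx S2 /\ convex_mx S2)
  (hT1clos : clos T1 = [set Phi | C1 Phi /\ S1 (\sum_(m < M) Phi m)])
  (hT2clos : clos T2 = [set Phi | C2 Phi /\ S2 (\sum_(m < M) Phi m)])
  (hC12 : C1 `<=` C2) (hC2G : C2 `<=` @CG R NV NW T M)
  (hS12 : S1 `<=` S2) (hS2G : S2 `<=` @SG R NV NW T)
  (hP1clos : clos (Pfeas a b T1) = [set Phi | clos T1 Phi /\ forall j, eta_j a b j Phi <= 0])
  (hP2clos : clos (Pfeas a b T2) = [set Phi | clos T2 Phi /\ forall j, eta_j a b j Phi <= 0])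
  (hP1ne : Pfeas a b T1 !=set0)
  (hD2opt : exists p, Dopt c a b C2 S2 p) :
  let s1 := Pval c a b T1 = Pval c a b T2 in
  let s2 := exists p, [/\ Dopt c a b C1 S1 p, Dfeas c a C2 p &
                          lambdaS S1 p.1 = lambdaS S2 p.1] in
  let s3 := forall p, Dopt c a b C2 S2 p -> Dopt c a b C1 S1 p in
  let s4 := exists p, [/\ Dopt c a b C1 S1 p, Dfeas c a C2 p &
                          linspan (@chn R NV NW T) p.1] in
  [/\ (s1 <-> s2), (s2 -> s3) &
      (S2 = @SG R NV NW T -> [/\ (s1 <-> s2), (s1 <-> s3) & (s1 <-> s4)])].
Proof.
move=> s1 s2 s3 s4.
have bnd S : S `<=` @SG R NV NW T -> (forall phi, S phi -> psd phi) /\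
    (forall phi, S phi -> hinner phi 1%:M <= wdim NW T).
  move=> SSG; split=> phi /SSG/(SG_tester_gt0 _ hT); first exact: tester_psd.
  exact: tester_trace.
have [psd1' tr1] := bnd _ (subset_trans hS12 hS2G).
have [psd2 tr2] := bnd _ hS2G.
have [cl1 [cv1 co1]] := hC1; have [cl2 [cv2 co2]] := hC2.
have hP2ne : Pfeas a b T2 !=set0.
  by have [Phi [TPhi ePhi]] := hP1ne; exists Phi; split=> //; exact: hT12.
have sd1 : Pval c a b T1 = Dval c a b C1 S1.
  apply: (strong_duality hc ha cl1 cv1 co1 (proj1 hS1) (proj2 hS1) hT1clos
    (subset_trans hC12 hC2G) psd1' tr1 hP1clos hP1ne).
have sd2 : Pval c a b T2 = Dval c a b C2 S2.
  by apply: (strong_duality hc ha cl2 cv2 co2 (proj1 hS2) (proj2 hS2) hT2clos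
    hC2G psd2 tr2 hP2clos hP2ne).
have S1ne : S1 !=set0.
  have [Phi TPhi] := hT1ne; exists (\sum_m Phi m).
  by have := sub_clos TPhi; rewrite hT1clos => -[].
have feas21 p : Dfeas c a C2 p -> Dfeas c a C1 p.
  by case=> h1 h2 [h3 h4]; split=> //; split=> // Phi /hC12; exact: h4.
have opt21 p : s1 -> Dopt c a b C2 S2 p ->
    Dopt c a b C1 S1 p /\ lambdaS S1 p.1 = lambdaS S2 p.1.
  move=> e1 [f2 v2]; have f1 := feas21 _ f2.
  have le : (Dobj b S1 p <= Dobj b S2 p)%E by rewrite leeD2r // lambdaS_le.
  have E12 : Dval c a b C1 S1 = Dobj b S2 p by rewrite v2 -sd1 -sd2.
  have E1 : Dobj b S1 p = Dval c a b C1 S1.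
    apply/eqP; rewrite eq_le {1}E12 le; apply: ereal_inf_lbound; by exists p.
  split; first by split.
  (* The term in [q] and [b] is finite, so it cancels even where a support value might be
     infinite. *)
  move: E1; rewrite E12 => /(congr1 (fun x => x - (\sum_j p.2 j * b j)%:E)%E).
  by rewrite /Dobj !addeK.
have s21 : s2 -> s1.
  move=> [p [[f1 v1] f2 l12]]; apply/eqP; rewrite eq_le; apply/andP; split.
    apply: ereal_sup_le => _ [Phi [TPhi ePhi] <-]; exists Phi => //.
    by split=> //; exact: hT12.
  rewrite sd1 sd2 -v1 /Dobj l12; apply: ereal_inf_lbound; by exists p.
have s12 : s1 -> s2.
  move=> e1; have [p o2] := hD2opt; have [o1 l12] := opt21 _ e1 o2.
  by exists p; split=> //; case: o2.
have s13 : s1 -> s3 by move=> e1 p o2; have [] := opt21 _ e1 o2.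
split; [by split|by move=> /s21|move=> S2G].
have S2ne : S2 !=set0 by have [phi /hS12] := S1ne; exists phi.
have s42 : s4 -> s2.
  move=> [p [o1 f2 lin]]; exists p; split=> //.
  have [k hk] := linspan_chn_const hT lin.
  rewrite (lambdaS_const S1ne (k := k)); last by move=> phi /hS12/hS2G/hk.
  by rewrite (lambdaS_const S2ne (k := k)) // => phi /hS2G/hk.
have s34 : s3 -> s4.
  move=> h3; have [p o2] := hD2opt; have [f2 v2] := o2.
  (* In dimension zero every matrix is the empty combination; otherwise [icomb] is available. *)
  have [d0|d0] := posnP (dimD NV NW T).
    exists p; split=> //; first exact: h3.
    exists 0%N, (fun=> 0), (fun=> 0); split; first by case.
    by apply/matrixP => i; have := ltn_ord i; rewrite [X in (_ < X)%N]d0.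
  have [hchi q0 [hz hdual]] := f2.
  have lfin : lambdaS S2 p.1 \is a fin_num.
    by rewrite S2G; apply: lambdaS_SG_fin => //; rewrite -S2G.
  have [chi' [lc pc]] : exists chi', lcomb NV NW T (fine (lambdaS S2 p.1)) chi' /\
      psd (chi' - p.1).
    apply: tester_duality => // phi /(SG_tester_gt0 _ hT) Sphi.
    rewrite -lee_fin fineK //; apply: ereal_sup_ubound.
    by exists phi => //; rewrite S2G.
  have hchi' := lcomb_herm lc.
  (* Raising [p.1] by a psd operator keeps dual feasibility because the members of [C2] are psd. *)
  have f2' : Dfeas c a C2 (chi', p.2).
    split=> //=; split=> [m|Phi CPhi]; first by apply: hermB => //; exact: herm_zq.
    have -> : \sum_m hinner (Phi m) (chi' - zq c a p.2 m)
       = \sum_m hinner (Phi m) (p.1 - zq c a p.2 m) + \sum_m hinner (Phi m) (chi' - p.1).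
      rewrite -big_split /=; apply: eq_bigr => m _; rewrite -hinnerDr; congr hinner.
      by rewrite [RHS]addrC addrA subrK.
    apply: addr_ge0; first exact: hdual.
    apply: sumr_ge0 => m _; apply: psd_hinner_ge0 => //; exact: (hC2G _ CPhi).
  have lE : lambdaS S2 chi' = lambdaS S2 p.1.
    rewrite (lambdaS_const S2ne (k := fine (lambdaS S2 p.1))) ?fineK // => phi.
    by move=> /hS2G/(SG_tester_gt0 _ hT) tphi; exact: (tester_lcomb tphi lc).
  exists (chi', p.2); split=> //; last exact: (lcomb_linspan hT d0 lc).
  (* The new point has the same objective, so it is optimal for (D_2), and (3) carries it to
     (D_1). *)
  by apply: h3; split=> //; rewrite /Dobj lE.
split; split=> //.
- by move=> /s34/s42/s21.
- by move=> /s13/s34.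
- by move=> /s42/s21.
Qed.
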